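(* Let $G$ be a countable, finitely generated amenable group and let $A$ be a finite set. Then for every $c \geq 0$, the set $\mathfrak{S}_c$ of shifts in $A^G$ with entropy exactly $c$ is comeagre in the space $\mathfrak{S}_{\geq c}$ of shifts in $A^G$ with entropy at least $c$ (with the topology induced from the space $\mathfrak{S}$ of all shifts in $A^G$).
   Context: $A^G$ carries the product topology ($A$ discrete), and $G$ acts on it by $[gx](h)=x(g^{-1}h)$. A shift is a closed $G$-invariant subset $X\subseteq A^G$. For finite $K\subset G$, $x_K$ is the restriction of $x$ to $K$ and $X_K=\{x_K : x\in X\}$. The space $\mathfrak{S}$ of all shifts in $A^G$ has the Hausdorff topology, which is compact and Polish; $X^n\to X$ if and only if for every finite $K\subset G$ one has $X^n_K=X_K$ for all large enough $n$. Fix a left-invariant word metric $d$ on $G$, and let $B_r=\{g\in G: d(e,g)\le r\}$. For finite $F\subset G$ let $\partial_rF=\{g\in G: gB_r\cap F\ne\emptyset \text{ and } gB_r\cap(G\setminus F)\neq\emptyset\}$ and $\rho_r(F)=|\partial_rF|/|F|$. A sequence $(F_n)$ of finite subsets of $G$ is Følner if $\lim_n\rho_r(F_n)=0$ for every $r\in\mathbb{N}$. The entropy of a shift $X$ is $h(X)=\lim_{n\to\infty}\frac{1}{|F_n|}\log|X_{F_n}|$ for any Følner sequence $(F_n)$ (the limit exists and does not depend on the sequence). A subset of a topological space is comeagre if it contains a dense $G_\delta$ subset. $\mathfrak{S}_{\ge c}=\{X\in\mathfrak{S}: h(X)\ge c\}$ and $\mathfrak{S}_{c}=\{X\in\mathfrak{S}: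 h(X)= c\}$.
   Formalization: ''Countable'' is taken to mean countably infinite; for finite G the claim fails (e.g. G trivial, A = {0,1}, c = 0: the full shift is isolated in the space of shifts with entropy at least 0 but has entropy log 2). *)

(* Defs.v *)
From HB Require Import structures.
From mathcomp Require Import all_boot all_order all_algebra finmap.
From mathcomp Require Import all_classical all_reals all_analysis.
From mathcomp Require Import borel_hierarchy.

Set Implicit Arguments.
Unset Strict Implicit.
Unset Printing Implicit Defensive.

Import Order.TTheory GRing.Theory Num.Theory.
Import numFieldNormedType.Exports.

Local Open Scope classical_set_scope.
Local Open Scope ring_scope.

(* A subset is comeagre if it contains a dense G_delta. *)
Definition comeagre (T : topologicalType) (Y : set T) : Prop :=
  exists D : set T, [/\ Gdelta D, dense D & D `<=` Y].

Section WordMetric.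
Variables (G : groupType) (S : {fset G}).
Local Open Scope group_scope.

Definition word_over (w : seq G) : bool :=
  all (fun s => (s \in S) || (s^-1 \in S)) w.

Definition generates : Prop :=
  forall g : G, exists2 w, word_over w & \prod_(s <- w) s = g.

Definition word_sizes (g : G) : set nat :=
  [set n | exists w, [/\ word_over w, \prod_(s <- w) s = g & size w = n]].

(* The least element of [word_sizes g], which is nonempty when [S] generates. *)
Definition word_length (g : G) : nat :=
  get [set n | word_sizes g n /\ forall m, word_sizes g m -> (n <= m)%N].

Definition word_metric (g h : G) : nat := word_length (g^-1 * h).

Definition word_ball (r : nat) : set G := [set g | (word_metric 1 g <= r)%N].

Definition boundary (r : nat) (F : {fset G}) : set G :=
  [set g | (exists2 b, word_ball r b & g * b \in F) /\
           (exists2 b, word_ball r b & g * b \notin F)].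

End WordMetric.

Section Folner.
Variables (R : realType) (G : groupType) (S : {fset G}).

(* [boundary S r F] is finite when [S] generates [G]. *)
Definition boundary_ratio (r : nat) (F : {fset G}) : R :=
  #|` fset_set (boundary S r F)|%:R / #|` F|%:R.

(* Nonemptiness is implicit in the division by |F|; it has to be spelled out
   because division by 0 is total. *)
Definition folner (F : nat -> {fset G}) : Prop :=
  (forall n, F n != fset0) /\
  (forall r : nat, boundary_ratio r (F n) @[n --> \oo] --> (0 : R)).

Definition amenable : Prop := exists F : nat -> {fset G}, folner F.

End Folner.

Definition configuration (G : groupType) (A : finType) : uniformType :=
  {ptws G -> discrete_topology A}.

Section Shifts.
Variables (G : groupType) (A : finType).

Definition translate (g : G) (x : configuration G A) : configuration G A :=
  fun h => x (g^-1 * h)%g.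

Record subshift : Type := Subshift {
  shift_set :> set (configuration G A) ;
  shift_closed : closed shift_set ;
  shift_invariant : forall g x, shift_set x -> shift_set (translate g x) }.

Lemma shift_inj : injective shift_set.
Proof.
move=> [X cX iX] [Y cY iY] /= XY; subst Y.
by rewrite (Prop_irrelevance cX cY) (Prop_irrelevance iX iY).
Qed.

HB.instance Definition _ := gen_eqMixin subshift.
HB.instance Definition _ := gen_choiceMixin subshift.

Definition restriction (K : {fset G}) (x : configuration G A) : {ffun K -> A} :=
  [ffun k => x (\val k)].

Definition patterns (K : {fset G}) (X : set (configuration G A)) :
    {set {ffun K -> A}} :=
  finset (fun p => `[< exists2 x, X x & restriction K x = p >]).

End Shifts.

(* Two sets are [hausdorff_ent E]-close if each lies in the [E]-neighbourhood
   of the other. *)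
Definition hausdorff_ent (U : uniformType) (E : set (U * U)) :
    set (set U * set U) :=
  [set XY | (forall x, XY.1 x -> exists2 y, XY.2 y & E (x, y)) /\
            (forall y, XY.2 y -> exists2 x, XY.1 x & E (x, y))].

(* The Hausdorff uniformity on shifts: its topology is that of the Hausdorff
   distance for any metric inducing the uniformity of [configuration G A]. *)
Section HausdorffTopology.
Variables (G : groupType) (A : finType).
Local Open Scope relation_scope.

Definition shift_ent : set_system (subshift G A * subshift G A) :=
  filter_from (@entourage (configuration G A))
    (fun E => [set XY : subshift G A * subshift G A |
                hausdorff_ent E (shift_set XY.1, shift_set XY.2)]).

Lemma shift_ent_filter : Filter shift_ent.
Proof.
apply: filter_from_filter; first by exists setT; exact: filterT.
move=> E E' eE eE'; exists (E `&` E'); first exact: filterI.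
move=> [X Y] [/= h1 h2]; split; split => /= x /=.
- by move=> /h1[y Yy []]; exists y.
- by move=> /h2[y Yy []]; exists y.
- by move=> /h1[y Yy []]; exists y.
- by move=> /h2[y Yy []]; exists y.
Qed.

Lemma shift_ent_diagonal B : shift_ent B -> diagonal `<=` B.
Proof.
move=> [E eE EB] [X Y] /= XY; apply: EB; rewrite /diagonal/= in XY.
by rewrite XY; split => /= x Xx; exists x => //; exact: entourage_refl.
Qed.

Lemma shift_ent_inv B : shift_ent B -> shift_ent B^-1.
Proof.
move=> [E eE EB]; exists E^-1; first exact: entourage_inv.
by move=> [X Y] /= [h1 h2]; apply: EB; split.
Qed.

Lemma shift_ent_split B : shift_ent B ->
  exists2 C, shift_ent C & C \; C `<=` B.
Proof.
move=> [E eE EB]; have [E' eE' E'E] := entourage_split_ex eE.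
exists [set XY : subshift G A * subshift G A |
    hausdorff_ent E' (shift_set XY.1, shift_set XY.2)]; first by exists E'.
move=> [X Z] /= [Y [/= h1 h2] [/= h3 h4]]; apply: EB; split => /= x.
- move=> /h1[y /h3[z Zz yz] xy]; exists z => //.
  by apply: E'E; exists y.
- move=> /h4[y /h2[z Zz yz] xy]; exists z => //.
  by apply: E'E; exists y.
Qed.

HB.instance Definition _ := isUniform.Build (subshift G A)
  shift_ent_filter shift_ent_diagonal shift_ent_inv shift_ent_split.

End HausdorffTopology.

(* Sanity check: [X^n --> X] iff, for each finite [K], the [K]-patterns of [X^n]
   are eventually those of [X]. *)
Section Convergence.
Variables (G : groupType) (A : finType).
Local Notation X := (configuration G A).

Lemma entourage_agree (K : {fset G}) :
  entourage ([set xy | forall k, k \in K -> xy.1 k = xy.2 k] : set (X * X)).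
Proof.
have -> : ([set xy | forall k, k \in K -> xy.1 k = xy.2 k] : set (X * X)) =
  \bigcap_(k in [set` K]) [set xy : X*X | xy.1 k = xy.2 k].
  by apply/seteqP; split => xy.
apply: filter_bigI => k _.
set E := (X in entourage X).
pose D : set (discrete_topology A * discrete_topology A) := diagonal.
have eD : entourage D by move=> ? [w _ <-].
have eE : @entourage (initial_topology (@proj G (fun=> discrete_topology A) k)) E.
  by exists D.
exists E => //.
exists [fset (exist (fun p : {classic G} * set (X*X) => `[< @entourage (initial_topology (@proj G (fun=> discrete_topology A) p.1)) p.2 >]) (k, E) (asboolT eE))]%fset => //.
  by move=> z _; apply/mem_set.
apply/seteqP; split => z /=.
  by move=> /(_ (exist _ (k, E) (asboolT eE)) ); apply; rewrite /= inE.
by move=> Ez i; rewrite /= inE => /eqP ->.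
Qed.

Lemma entourage_agree_ex (E : set (X * X)) : entourage E ->
  exists K : {fset G}, forall x y : X, (forall k, k \in K -> x k = y k) -> E (x, y).
Proof.
move=> [_ [D _ <-]] sub.
have fin : finite_set ((fun i => (val i).1 : G) @` [set` D]).
  by apply: finite_image; exact: finite_fset.
exists (fset_set ((fun i => (val i).1 : G) @` [set` D])) => x y xy; apply: sub => i iD.
have xk : x (val i).1 = y (val i).1.
  by apply: xy; rewrite in_fset_set// inE; exists i.
case: i {iD} xk => -[k B] /= eB; have /asboolP[B' eB' sB] := eB => xk.
apply: sB => /=; apply: eB'.
exists (x k) => //; by rewrite /unstable.map_pair/= /proj xk.
Qed.

Lemma nbhs_subshiftP (Z : subshift G A) U : nbhs Z U <-> exists K : {fset G},
  forall Y : subshift G A, patterns K Y = patterns K Z -> U Y.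
Proof.
split.
  move=> [B [E eE EB] BU]; have [K KE] := entourage_agree_ex eE; exists K => Y YZ.
  apply: BU; apply/xsectionP/EB; split => /= x.
    move=> Zx; have : restriction K x \in patterns K Z.
      by rewrite inE; apply/asboolP; exists x.
    rewrite -YZ inE => /asboolP[y Yy yx]; exists y => //; apply: KE => k kK.
    by move/ffunP: yx => /(_ [` kK]%fset); rewrite !ffunE.
  move=> Yx; have : restriction K x \in patterns K Y.
    by rewrite inE; apply/asboolP; exists x.
  rewrite YZ inE => /asboolP[y Yy yx]; exists y => //; apply: KE => k kK.
  by move/ffunP: yx => /(_ [` kK]%fset); rewrite !ffunE.
move=> [K KU].
exists [set XY : subshift G A * subshift G A |
   hausdorff_ent [set xy : X*X | forall k, k \in K -> xy.1 k = xy.2 k]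
   (shift_set XY.1, shift_set XY.2)].
  by eexists; first exact: (entourage_agree K).
move=> Y /xsectionP [/= h1 h2]; apply: KU; apply/setP => p; rewrite !inE.
apply/asboolP/asboolP => -[x].
  move=> /h2[y Zy yx] <-; exists y => //; by apply/ffunP => k; rewrite !ffunE; first [apply: yx | apply/esym/yx]; exact: fsvalP.
move=> /h1[y Zy yx] <-; exists y => //; by apply/ffunP => k; rewrite !ffunE; first [apply: yx | apply/esym/yx]; exact: fsvalP.
Qed.

Lemma cvg_subshiftP (Z_ : nat -> subshift G A) (Z : subshift G A) :
  Z_ n @[n --> \oo] --> Z <->
  forall K : {fset G}, \forall n \near \oo, patterns K (Z_ n) = patterns K Z.
Proof.
split.
  by move=> cv K; apply: (cv [set Y : subshift G A | patterns K Y = patterns K Z]);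
   apply/nbhs_subshiftP; exists K.
move=> h U /nbhs_subshiftP[K KU]; near=> n; apply: KU; near: n; exact: h.
Unshelve. all: by end_near. Qed.

End Convergence.

Section Entropy.
Variables (R : realType) (G : groupType) (S : {fset G}) (A : finType).

(* [lne 0 = -oo], so the empty shift has entropy [-oo]. *)
Definition pattern_rate (F : {fset G}) (X : subshift G A) : \bar R :=
  ((#|` F|%:R^-1)%:E * lne (#|patterns F X|%:R%:E))%E.

Definition is_entropy (X : subshift G A) (h : \bar R) : Prop :=
  forall F : nat -> {fset G}, folner R S F ->
    pattern_rate (F n) X @[n --> \oo] --> h.

(* For amenable [G] the value [h] exists and is unique. *)
Definition entropy (X : subshift G A) : \bar R := get (is_entropy X).

Definition shifts_ge (c : R) : set (subshift G A) :=
  [set X | (c%:E <= entropy X)%E].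

Definition shifts_eq (c : R) : set (subshift G A) :=
  [set X | entropy X = c%:E].

End Entropy.

Arguments shifts_ge {R G} S A c.
Arguments shifts_eq {R G} S A c.

(* Main.v *)
(* The shifts of entropy [< c + 1/n] form an open set because the entropy is the
   infimum of [ln |X_F| / |F|] over all nonempty finite [F], by Shearer's
   inequality; so [S_c] is a G_delta in [S_{>= c}], and it remains to prove density.

   Given [X], [K] and a finite [F0], let [W] be the shift of finite type with the
   same [K u F0]-patterns as [X]. Choose a Folner set [F] and markers [D] of [G], in
   such a way that the translates [d F], each cut by those of smaller colour, are
   disjoint tiles, have total boundary of small density, and cover half of [G]. Since
   [W] is of finite type, the interior of each tile can be refilled independently by
   a filling that depends only on the rest of the tile. Refilling the interiors
   completely leaves half of the cells free, and these form an almost invariant set,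
   so Shearer's inequality bounds the new entropy by half of [ln |X_F0| / |F0|] up to
   a small error. Refilling one position of [F] at a time instead, each step changes
   one cell per tile and hence the entropy by very little. So either some shift in
   the chain has entropy in [[c, c + eps)], or the last one still has entropy
   [>= c + eps] and the construction can be repeated; the entropy being halved
   essentially each time, this stops.

   Iterating with [eps -> 0] and larger and larger [K] gives a sequence of shifts
   that converges to a shift of entropy exactly [c]. *)
Require Import Defs.
From mathcomp Require Import all_boot all_order all_algebra finmap.
From mathcomp Require Import all_classical all_reals all_analysis.
From mathcomp Require Import ring lra zify.

Set Implicit Arguments.
Unset Strict Implicit.
Unset Printing Implicit Defensive.

Import Order.TTheory GRing.Theory Num.Theory.
Import numFieldNormedType.Exports.

Local Open Scope classical_set_scope.
Local Open Scope ring_scope.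

(** * Counting patterns *)

(** Counting the values of an arbitrary map allows markers, traces and configurations to be counted
    jointly; for a restriction map this is the number of patterns, by definition. *)
Definition nimg (T : Type) (I : finType) (f : T -> I) (P : set T) : nat :=
  #|finset (fun i => `[< exists2 x, P x & f x = i >])|.

Section Counting.
Variables (T : Type) (I J : finType).
Implicit Types (f : T -> I) (g : T -> J) (P : set T).

Lemma nimg_pair f g P : (nimg (fun x => (f x, g x)) P <= nimg f P * nimg g P)%N.
Proof.
rewrite /nimg -cardsX; apply/subset_leq_card/fintype.subsetP => -[i j].
rewrite !inE => -[x Px [<- <-]] /=.
by apply/andP; split; apply/asboolP; exists x.
Qed.

Lemma nimg_fiber f g P m :
    (forall x0, P x0 -> (nimg f (P `&` [set x | g x = g x0]) <= m)%N) ->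
  (nimg f P <= nimg g P * m)%N.
Proof.
move=> fib; pose Jm := finset (fun j => `[< exists2 x, P x & g x = j >]).
pose fi j := finset (fun i => `[< exists2 x, (P `&` [set x | g x = j]) x & f x = i >]).
apply: (@leq_trans #|\big[@finset.setU I/finset.set0]_(j in Jm) fi j|).
  apply/subset_leq_card/fintype.subsetP => i; rewrite finset.in_set => /asboolP[x Px xi].
  apply/finset.bigcupP; exists (g x); rewrite finset.in_set; apply/asboolP; first by exists x.
  by exists x.
apply: (@leq_trans (\sum_(j in Jm) #|fi j|)); first elim/big_rec2: _ => [|j n B _ leB].
- by rewrite cards0.
- by rewrite (leq_trans (leq_card_setU _ _))// leq_add2l.
rewrite /nimg -sum_nat_const; apply: leq_sum => j.
by rewrite finset.in_set => /asboolP[x Px <-]; exact: fib.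
Qed.

Lemma nimg_gt0 f P : P !=set0 -> (0 < nimg f P)%N.
Proof.
by move=> [x Px]; apply/card_gt0P; exists (f x); rewrite finset.in_set; apply/asboolP; exists x.
Qed.

End Counting.

(** Sending the [g]-value of a point to the [f]-value of a related point is a well-defined partial
    map that hits every value of [f] on [P]. With a relation, no related point has to be chosen. *)
Lemma nimg_le (T T' : Type) (I J : finType) (f : T -> I) (g : T' -> J)
    (P : set T) (Q : set T') (rel : T -> T' -> Prop) :
    (forall x, P x -> exists2 y, Q y & rel x y) ->
    (forall x x' y y', P x -> P x' -> rel x y -> rel x' y' -> g y = g y' -> f x = f x') ->
  (nimg f P <= nimg g Q)%N.
Proof.
move=> ex det; pose Q' := finset (fun j => `[< exists2 y, Q y & g y = j >]).
pose h j := [pick i | `[< exists x y, [/\ P x, rel x y, g y = j & f x = i] >]].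
have Si : injective (@Some I) by move=> ? ? [].
rewrite /nimg -(card_imset _ Si); apply: leq_trans (leq_imset_card h (mem Q')).
apply/subset_leq_card/fintype.subsetP => _ /imsetP[i + ->].
rewrite finset.in_set => /asboolP[x Px <-]; have [y Qy xy] := ex x Px.
apply/imsetP; exists (g y); first by rewrite finset.in_set; apply/asboolP; exists y.
rewrite /h; case: pickP => [i' /asboolP[x' [y' [Px' xy' gy <-]]]|/(_ (f x))].
  by congr Some; apply: det xy xy' _.
by move=> /asboolP; case; exists x, y.
Qed.

Section Patterns.
Variables (G : groupType) (A : finType).
Implicit Types (K Q : {fset G}) (P : set (configuration G A)).

Lemma restrictionP K (x y : configuration G A) :
  restriction K x = restriction K y <-> forall k, k \in K -> x k = y k.
Proof.
split=> [/ffunP xy k kK|xy].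
  by have := xy [` kK]%fset; rewrite !ffunE.
by apply/ffunP => k; rewrite !ffunE; apply: xy; exact: fsvalP.
Qed.

Lemma patternsE K P : #|patterns K P| = nimg (@restriction G A K) P.
Proof. by []. Qed.

Lemma patterns_subset K P P' :
    (forall x, P x -> exists2 y, P' y & forall k, k \in K -> x k = y k) ->
  patterns K P \subset patterns K P'.
Proof.
move=> PP'; apply/fintype.subsetP => p; rewrite !inE => -[x /PP'[y Py xy] <-].
by exists y => //; apply/esym/restrictionP.
Qed.

Lemma patterns_subset_ex K P P' x : patterns K P \subset patterns K P' ->
  P x -> exists2 y, P' y & forall k, k \in K -> x k = y k.
Proof.
move=> /fintype.subsetP /(_ (restriction K x)); rewrite !inE => PP' Px.
by have [|y P'y /restrictionP yx] := PP' _; [exists x|exists y => // k /yx].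
Qed.

Lemma leq_patterns K K' P P' : {subset K <= K'} ->
    (forall x, P x -> exists2 y, P' y & forall k, k \in K -> x k = y k) ->
  (#|patterns K P| <= #|patterns K' P'|)%N.
Proof.
move=> KK' PP'; rewrite !patternsE.
apply: (nimg_le (rel := fun x y => forall k, k \in K -> x k = y k)) => //.
move=> x x' y y' _ _ xy xy' /restrictionP yy'; apply/restrictionP => k kK.
by rewrite xy// xy'// yy'// KK'.
Qed.

Lemma leq_patternsS K K' P : {subset K <= K'} ->
  (#|patterns K P| <= #|patterns K' P|)%N.
Proof. by move=> KK'; apply: leq_patterns => // x Px; exists x. Qed.

Lemma leq_patterns_max K P : (#|patterns K P| <= #|A| ^ #|` K|)%N.
Proof. by rewrite (leq_trans (max_card _))// card_ffun -cardfE. Qed.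

Lemma patterns_split P Q q : q \in Q ->
  #|patterns Q P| = (\sum_(a in A) #|patterns (Q `\ q)%fset (P `&` [set x | x q = a])|)%N.
Proof.
move=> qQ; rewrite -sum1_card.
rewrite (partition_big (fun p : {ffun Q -> A} => p [` qQ]%fset) (mem A))//=.
apply: eq_bigr => a _; rewrite sum1_card.
transitivity (nimg (@restriction G A Q) (P `&` [set x | x q = a])).
  apply: eq_card => p; rewrite unfold_in /= !inE; apply/andP/asboolP.
    by move=> [/asboolP[x Px <-]]; rewrite ffunE => /eqP xq; exists x.
  by move=> [x [Px xq] <-]; split; [apply/asboolP; exists x|rewrite ffunE/= xq].
apply/eqP; rewrite eqn_leq; apply/andP; split;
  apply: (nimg_le (rel := fun x y => x = y)) => [x Px|x x' y y']; try by exists x.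
- move=> [_ /= xq] [_ /= xq'] <- <- {y y'} /restrictionP xx'; apply/restrictionP => k kK.
  have [->|kq] := eqVneq k q; first by rewrite xq xq'.
  by apply: xx'; rewrite !inE kq.
- move=> _ _ <- <- {y y'} /restrictionP xx'; apply/restrictionP => k.
  by rewrite !inE => /andP[_ kK]; exact: xx'.
Qed.

End Patterns.

(** * Shearer's inequality *)

Section Shearer.
Variable R : realType.

(** Hoelder's inequality with [#|B|] equal exponents, written with powers instead of roots: unless
    the right-hand side vanishes, AM-GM applies to the normalised factors [v i a / S i]. In
    [shearer], [C] collects the sets that miss the removed point. *)
Lemma prod_sum_hoelder (A I : finType) (B : {set I}) (C : R) (u : A -> R)
    (v : I -> A -> R) :
    (0 < #|B|)%N -> 0 <= C -> (forall a, 0 <= u a) -> (forall i a, 0 <= v i a) ->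
    (forall a, u a ^+ #|B| <= C * \prod_(i in B) v i a) ->
  (\sum_a u a) ^+ #|B| <= C * \prod_(i in B) \sum_a v i a.
Proof.
move=> B0 C0 u0 v0 uv; set k := #|B|; pose S i := \sum_a v i a.
have S0 i : 0 <= S i by exact: sumr_ge0.
have SC0 : 0 <= C * \prod_(i in B) S i by rewrite mulr_ge0// prodr_ge0.
have [SC_eq0|SCn0] := eqVneq (C * \prod_(i in B) S i) 0.
  suff u_eq0 a : u a = 0 by rewrite big1// expr0n gtn_eqF.
  suff : C * \prod_(i in B) v i a = 0.
    move=> vC; have := uv a; rewrite vC => ua.
    apply/eqP; have : u a ^+ #|B| == 0 by rewrite eq_le ua exprn_ge0.
    by rewrite expf_eq0 B0.
  move/eqP: SC_eq0; rewrite mulf_eq0 => /orP[/eqP->|/prodf_eq0[i iB /eqP Si]].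
    by rewrite mul0r.
  rewrite (bigD1 i)//= (@psumr_eq0P _ _ xpredT (v i))//.
  by rewrite mul0r mulr0.
have W0 : 0 < C * \prod_(i in B) S i by rewrite lt_def SCn0.
have Sn0 i : i \in B -> S i != 0.
  move=> iB; apply: contraNneq SCn0 => Si.
  by rewrite (bigD1 i)//= Si mul0r mulr0.
(* [t] is the [k]-th root of [W]. The numbers [avg a] below sum to 1, so [u a <= t * avg a] is
   enough. *)
set W := C * _ in W0 *; pose t := expR (ln W / k%:R).
have kn0 : k%:R != 0 :> R by rewrite pnatr_eq0 -lt0n.
have tk : t ^+ k = W by rewrite -expRM_natl mulrC mulfVK// lnK.
pose avg a := (\sum_(i in B) v i a / S i) / k%:R.
have avg0 a : 0 <= avg a.
  by rewrite divr_ge0// sumr_ge0// => i _; rewrite divr_ge0.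
have le_avg a : u a <= t * avg a.
  rewrite -(@ler_pXn2r _ k)// ?nnegrE// ?mulr_ge0 ?expR_ge0//.
  rewrite exprMn tk (le_trans (uv a))//.
  have -> : \prod_(i in B) v i a = \prod_(i in B) S i * \prod_(i in B) (v i a / S i).
    by rewrite -big_split/=; apply: eq_bigr => i iB; rewrite mulrCA divff ?mulr1// Sn0.
  rewrite mulrA ler_wpM2l// ?(ltW W0)//.
  have v0' : {in mem B, forall i, 0 <= v i a / S i} by move=> i _; exact: divr_ge0.
    by have [+ _] := leif_AGM v0'.
  by rewrite sumr_ge0// => i _; rewrite divr_ge0.
rewrite -tk; apply: lerXn2r; rewrite ?nnegrE ?sumr_ge0// ?expR_ge0//.
apply: (le_trans (ler_sum _ (fun a _ => le_avg a))).
rewrite -mulr_sumr -mulr_suml exchange_big/=.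
rewrite (eq_bigr (fun=> 1)); last first.
  by move=> i iB; rewrite -mulr_suml divff// Sn0.
by rewrite sumr_const divff// mulr1.
Qed.

(** Induction on the size of [Q]: the patterns are split by their value at a point [q]. The [k]
    factors with [q \in F i] become sums over this value, the others can only decrease, and
    [prod_sum_hoelder] recombines them. [P] is not assumed invariant because prescribing a value at
    [q] destroys invariance. *)
Lemma shearer (G : groupType) (A I : finType) (F : I -> {fset G}) (k : nat)
    (Q : {fset G}) (P : set (configuration G A)) :
    (0 < k)%N ->
    (forall q, q \in Q -> #|[set i | q \in F i]%SET| = k) ->
  #|patterns Q P|%:R ^+ k <= \prod_i #|patterns (Q `&` F i)%fset P|%:R :> R.
Proof.
move=> k0; have [n nQ] := ubnP #|` Q|; elim: n Q P nQ => // n IHn Q P Qn Fk.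
have [Q0|/fset0Pn[q qQ]] := eqVneq Q fset0.
  have [[x Px]|P0] := pselect (P !=set0).
    rewrite (@le_trans _ _ 1)//.
      by rewrite exprn_ile1// lern1 (leq_trans (leq_patterns_max _ _))// Q0 cardfs0 expn0.
    rewrite [leLHS](_ : 1 = \prod_(i : I) 1); last by rewrite big1.
    apply: ler_prod => i _; rewrite ler01 ler1n patternsE/=.
    by apply: nimg_gt0; exists x.
  rewrite patternsE (_ : nimg _ _ = 0%N) ?expr0n ?gtn_eqF ?prodr_ge0//.
  apply/eqP; rewrite /nimg cards_eq0; apply/eqP/setP => p; rewrite finset.in_set finset.in_set0.
  by apply/asboolP => -[x Px]; case: P0; exists x.
pose B := [set i | q \in F i]%SET.
pose Pa a := P `&` [set x | x q = a].
have Bk : #|B| = k by exact: Fk.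
rewrite (patterns_split _ qQ) natr_sum -Bk (bigID (mem B))/= mulrC.
set C := \prod_(i | i \notin B) _.
have -> : \prod_(i in B) #|patterns (Q `&` F i)%fset P|%:R =
    \prod_(i in B) \sum_a #|patterns ((Q `&` F i) `\ q)%fset (Pa a)|%:R :> R.
  apply: eq_bigr => i; rewrite inE => qi.
  by rewrite (@patterns_split _ _ _ _ q) ?natr_sum// !inE qQ.
apply: (prod_sum_hoelder (v := fun i a => #|patterns ((Q `&` F i) `\ q)%fset (Pa a)|%:R)) => //.
- by rewrite Bk.
- by rewrite prodr_ge0.
move=> a; rewrite Bk; apply: le_trans (IHn (Q `\ q)%fset (Pa a) _ _) _.
- by move: Qn; rewrite (cardfsD1 q) qQ.
- by move=> r; rewrite !inE => /andP[_ rQ]; exact: Fk.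
rewrite (bigID (mem B))/= mulrC; apply: ler_pM; rewrite ?prodr_ge0//.
  apply: ler_prod => i iB; rewrite ler0n ler_nat; apply: leq_patterns => [r|x []].
    by rewrite !inE => /andP[/andP[_ ->]].
  by exists x.
apply: ler_prod => i iB; rewrite ler0n ler_nat; apply: leq_patternsS => r.
by rewrite !inE => /andP[/andP[-> ->]].
Qed.

End Shearer.

Lemma leq_card_inj (T T' : choiceType) (E : {fset T}) (E' : {fset T'}) (f : T -> T') :
    {in E &, injective f} -> (forall x, x \in E -> f x \in E') ->
  (#|` E| <= #|` E'|)%N.
Proof.
move=> finj fE; have <- : #|` [fset f x | x in E]%fset| = #|` E|.
  by rewrite card_in_imfset.
by apply: fsubset_leq_card; apply/fsubsetP => _ /imfsetP[x /= xE ->]; exact: fE.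
Qed.

(** * Products, inverses and translates of finite subsets of the group *)

Section FiniteProducts.
Variable G : groupType.
Implicit Types (E L F : {fset G}) (g h : G).
Local Open Scope group_scope.

Definition fmul E L : {fset G} := [fset x * y | x in E, y in L]%fset.
Definition finv L : {fset G} := [fset x^-1 | x in L]%fset.
Definition ftrans g F : {fset G} := [fset g * x | x in F]%fset.

Lemma fmulP E L h :
  reflect (exists x y, [/\ x \in E, y \in L & h = x * y]) (h \in fmul E L).
Proof.
apply: (iffP (imfset2P _ _ _ _ _)) => [[x xE [y yL ->]]|[x [y [xE yL ->]]]].
  by exists x, y.
by exists x => //; exists y.
Qed.

Lemma mem_fmul E L x y : x \in E -> y \in L -> x * y \in fmul E L.
Proof. by move=> xE yL; apply/fmulP; exists x, y. Qed.

Lemma mem_finv L x : (x \in finv L) = (x^-1 \in L).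
Proof.
apply/imfsetP/idP => [[y yL ->]|xL]; first by rewrite invgK.
by exists x^-1 => //; rewrite invgK.
Qed.

Lemma mem_ftrans g F h : (h \in ftrans g F) = (g^-1 * h \in F).
Proof.
apply/imfsetP/idP => [[y yL ->]|xL]; first by rewrite mulKg.
by exists (g^-1 * h) => //; rewrite mulVKg.
Qed.

Lemma card_ftrans g F : #|` ftrans g F| = #|` F|.
Proof. by rewrite card_imfset//; exact: mulgI. Qed.

Lemma card_finv F : #|` finv F| = #|` F|.
Proof. by rewrite card_imfset//; exact: invg_inj. Qed.

Lemma card_fmul E L : (#|` fmul E L| <= #|` E| * #|` L|)%N.
Proof.
have -> : fmul E L = (\bigcup_(x <- E) ftrans x L)%fset.
  apply/fsetP => h; apply/fmulP/bigfcupP.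
    by move=> [x [y [xE yL ->]]]; exists x; rewrite ?xE// mem_ftrans mulKg.
  by move=> [x /andP[xE _]]; rewrite mem_ftrans => xh; exists x, (x^-1 * h); rewrite mulVKg.
apply: (@leq_trans (\sum_(x <- E) #|` L|)); last first.
  by rewrite big_const_seq count_predT iter_addn_0 mulnC.
elim/big_rec2: _ => [|x n B _ leB]; first by rewrite cardfs0.
by rewrite (leq_trans (leq_card_fsetU _ _))// leq_add// card_ftrans.
Qed.

Lemma fmulS E E' L L' : {subset E <= E'} -> {subset L <= L'} ->
  {subset fmul E L <= fmul E' L'}.
Proof. by move=> EE LL h /fmulP[x [y [xE yL ->]]]; rewrite mem_fmul ?EE ?LL. Qed.

Lemma fmul1 E L : 1 \in L -> {subset E <= fmul E L}.
Proof. by move=> L1 x xE; apply/fmulP; exists x, 1; rewrite mulg1. Qed.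

Lemma card_fset_pred (T : choiceType) (K : {fset T}) (p : pred T) :
  #|[set i : K | p (val i)]%SET| = #|` [fset x in K | p x]%fset|.
Proof.
have -> : [fset x in K | p x]%fset = [fset val i | i in [set i : K | p (val i)]%SET]%fset.
  apply/fsetP => x; rewrite !inE /=; apply/andP/imfsetP => /=.
    by move=> [xK px]; exists [` xK]%fset; rewrite // inE.
  by move=> [i]; rewrite inE => pi ->; rewrite fsvalP.
by rewrite card_imfset //=; [rewrite -cardE | exact: val_inj].
Qed.

End FiniteProducts.

Definition invariant (G : groupType) (A : finType) (P : set (configuration G A)) :=
  forall g x, P x -> P (translate g x).

Lemma ln_prod (R : realType) (I : finType) (u : I -> R) :
  (forall i, 0 < u i) -> ln (\prod_i u i) = \sum_i ln (u i).
Proof.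
move=> u0; suff [] : ln (\prod_i u i) = \sum_i ln (u i) /\ 0 < \prod_i u i by [].
elim/big_rec2: _ => [|i y x _ [<- x0]]; first by rewrite ln1.
by rewrite lnM ?posrE// mulr_gt0.
Qed.

Section Covering.
Variables (R : realType) (G : groupType) (A : finType).
Variable P : set (configuration G A).
Hypotheses (invP : invariant P) (P0 : P !=set0).
Implicit Types (Q F B : {fset G}).

Lemma ln_patterns_ge0 K : 0 <= ln #|patterns K P|%:R :> R.
Proof. by rewrite ln_ge0// ler1n patternsE nimg_gt0. Qed.

Lemma alphabet_gt0 : (0 < #|A|)%N.
Proof. by have [x _] := P0; apply/card_gt0P; exists (x 1%g). Qed.

Lemma patterns_gt0 K : 0 < #|patterns K P|%:R :> R.
Proof. by rewrite ltr0n patternsE nimg_gt0. Qed.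

Lemma ln_patterns_max K : ln #|patterns K P|%:R <= #|` K|%:R * ln #|A|%:R :> R.
Proof.
rewrite mulr_natl -lnXn ?ltr0n ?alphabet_gt0// ler_ln ?posrE ?patterns_gt0//.
  by rewrite -natrX ler_nat leq_patterns_max.
by rewrite exprn_gt0// ltr0n alphabet_gt0.
Qed.

Lemma leq_patterns_ftrans F Q g : {subset Q <= ftrans g F} ->
  (#|patterns Q P| <= #|patterns F P|)%N.
Proof.
move=> QF; rewrite !patternsE.
apply: (nimg_le (rel := fun x y => y = translate g^-1%g x)).
  by move=> x Px; exists (translate g^-1%g x) => //; exact: invP.
move=> x x' _ _ _ _ -> -> /restrictionP xx'; apply/restrictionP => k /QF.
rewrite mem_ftrans => /xx'; rewrite /translate invgK.
by rewrite mulVKg.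
Qed.

(** Shearer's inequality for the translates [g F] with [g] in [Q F^-1], which cover each point of
    [Q] exactly [|F|] times. At most [|Q|] of them lie inside [Q], since [g] is recovered from
    [g f]; the others have [g] in [B] and are bounded by [|F| ln |A|]. *)
Lemma ln_patterns_cover Q F B : F != fset0 ->
    (forall g u v, u \in F -> v \in F -> (g * u)%g \in Q -> (g * v)%g \notin Q ->
      g \in B) ->
  ln #|patterns Q P|%:R <= #|` Q|%:R * (ln #|patterns F P|%:R / #|` F|%:R)
    + #|` B|%:R * ln #|A|%:R :> R.
Proof.
move=> F0 QB; pose T := fmul Q (finv F); have cF : (0 < #|` F|)%N by rewrite cardfs_gt0.
have a0 : 0 <= ln #|A|%:R :> R by rewrite ln_ge0// ler1n alphabet_gt0.
have := @shearer R G A T (fun i => ftrans (val i) F) #|` F| Q P cF.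
have cover q : q \in Q -> #|[set i : T | q \in ftrans (val i) F]%SET| = #|` F|.
  move=> qQ; rewrite (card_fset_pred _ (fun g => q \in ftrans g F)) -(card_finv F).
  rewrite -(card_ftrans q (finv F)); congr (#|` _|); apply/fsetP => g.
  rewrite !inE/= !mem_ftrans mem_finv invgM invgK andb_idl// => gF.
  by apply/fmulP; exists q, (q^-1 * g)%g; rewrite mem_finv invgM invgK mulVKg.
move=> /(_ cover).
rewrite -ler_ln ?posrE ?exprn_gt0 ?prodr_gt0 ?patterns_gt0//; last first.
  by move=> i _; rewrite patterns_gt0.
rewrite lnXn ?patterns_gt0// ln_prod; last by move=> i; rewrite patterns_gt0.
pose bad (i : T) := val i \in B.
pose good (i : T) := [forall f : F, (val i * val f)%g \in Q].
have bound i : ln #|patterns (Q `&` ftrans (val i) F)%fset P|%:R <=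
    (if good i then ln #|patterns F P|%:R else 0) +
    (if bad i then #|` F|%:R * ln #|A|%:R else 0) :> R.
  case: ifPn => [_|nall].
    rewrite -[leLHS]addr0 lerD//; last by case: ifP => // _; rewrite mulr_ge0.
    rewrite ler_ln ?posrE ?patterns_gt0// ler_nat.
    by apply: (@leq_patterns_ftrans _ _ (val i)) => q; rewrite inE => /andP[].
  rewrite ifT ?add0r.
    apply: le_trans (ln_patterns_max _) _; rewrite ler_wpM2r// ler_nat.
    by rewrite -(card_ftrans (val i) F) fsubset_leq_card// fsubsetIr.
  move: nall; rewrite negb_forall => /existsP[v vQ].
  have /fmulP[q [w [qQ]]] := fsvalP i.
  rewrite mem_finv => wF iE; apply: QB wF (fsvalP v) _ vQ.
  by rewrite [X in (X * _)%g](iE : val i = _) mulgK.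
move=> /le_trans /(_ (ler_sum _ (fun i _ => bound i))).
rewrite big_split -!big_mkcond !sumr_const => le_sum.
rewrite -(@ler_pM2l _ #|` F|%:R) ?ltr0n// mulr_natl (le_trans le_sum)//.
have Fn0 : #|` F|%:R != 0 :> R by rewrite pnatr_eq0 -lt0n.
rewrite mulrDr lerD//.
  rewrite mulrCA [_ * (_ / _)]mulrC divfK// -[leLHS]mulr_natl ler_wpM2r ?ln_patterns_ge0//.
  have /fset0Pn[f fF] := F0.
  rewrite ler_nat -cardsE (card_fset_pred _ (fun g => [forall f : F, (g * val f)%g \in Q])).
  apply: (leq_card_inj (f := fun g => (g * f)%g)) => [? ? _ _ /mulIg //|g].
  by rewrite !inE => /andP[_ /forallP /(_ [` fF]%fset)].
rewrite -[leLHS]mulr_natl mulrCA ler_wpM2l// ler_wpM2r//.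
rewrite ler_nat -cardsE (card_fset_pred _ (fun g => g \in B)).
by apply: fsubset_leq_card; apply/fsubsetP => g; rewrite !inE => /andP[].
Qed.

End Covering.

(** * Entropy as an infimum *)

Section WordBalls.
Variables (G : groupType) (S : {fset G}).
Hypothesis genS : generates S.
Local Open Scope group_scope.

Let letters : {fset G} := (S `|` finv S)%fset.

Fixpoint word_products n : {fset G} :=
  if n is m.+1 then (word_products m `|` fmul letters (word_products m))%fset
  else [fset 1]%fset.

Lemma mem_word_products w n : word_over S w -> (size w <= n)%N ->
  \prod_(s <- w) s \in word_products n.
Proof.
elim: n w => [|n IHn] [|s w] //=; rewrite ?big_nil ?big_cons.
- by rewrite inE.
- by move=> _ _; have := IHn [::] isT (leq0n _); rewrite big_nil inE => ->.
- move=> /andP[sS wS] ws; rewrite inE mem_fmul ?orbT// ?IHn//.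
  by rewrite inE mem_finv.
Qed.

Lemma word_length_spec g : word_sizes S g (word_length S g) /\
  forall m, word_sizes S g m -> (word_length S g <= m)%N.
Proof.
pose P := [set n | word_sizes S g n /\ forall m, word_sizes S g m -> (n <= m)%N].
suff: exists n, P n by move=> ex; exact: (@getPex _ P).
have [w wS wg] := genS g.
have ex : exists n, `[< word_sizes S g n >] by exists (size w); apply/asboolP; exists w.
case: (ex_minnP ex) => n /asboolP gn nmin; exists n; split=> // m gm.
by apply: nmin; exact/asboolP.
Qed.

Lemma finite_word_ball r : finite_set (word_ball S r).
Proof.
apply: (@sub_finite_set _ _ [set` word_products r]); last exact: finite_fset.
move=> g; rewrite /word_ball/= /word_metric invg1 mul1g => gr.
have [[w [wS wg ws]] _] := word_length_spec g.
by rewrite /= -wg; apply: mem_word_products; rewrite ?ws.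
Qed.

Lemma word_ball1 r : word_ball S r 1.
Proof.
rewrite /word_ball/= /word_metric invg1 mul1g.
have [_ /(_ 0%N)] := word_length_spec 1; move=> /(_ _)/leq_trans; apply=> //.
by exists [::]; rewrite big_nil.
Qed.

Lemma word_ball_cover (L : {fset G}) : exists r, forall l, l \in L -> word_ball S r l.
Proof.
exists (\max_(l : L) word_length S (val l)) => l lL.
rewrite /word_ball/= /word_metric invg1 mul1g.
exact: (@leq_bigmax _ (fun l : L => word_length S (val l)) [` lL]%fset).
Qed.

(** If [r] bounds the word lengths in [L], then [x \in F] and [x * l \notin F] make [x] a boundary
    point. *)
Lemma card_fmul_boundary (L : {fset G}) : exists r, forall F : {fset G},
  (#|` fmul F L| <= #|` F| + #|` fset_set (boundary S r F)| * #|` L|)%N.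
Proof.
have [r Lr] := word_ball_cover L; exists r => F.
have finB : finite_set (boundary S r F).
  apply: (@sub_finite_set _ _ [set` fmul F (finv (fset_set (word_ball S r)))]).
    move=> g [[b br gbF] _]; rewrite /= -(mulgK b g) mem_fmul// mem_finv invgK.
    by rewrite in_fset_set ?inE//; exact: finite_word_ball.
  exact: finite_fset.
apply: leq_trans (leq_add (leqnn _) (card_fmul _ _)).
apply: leq_trans (leq_card_fsetU _ _); apply: fsubset_leq_card; apply/fsubsetP.
move=> _ /fmulP[x [l [xF lL ->]]]; rewrite inE; have [//|xlF /=] := boolP (x * l \in F).
rewrite mem_fmul// in_fset_set// inE; split.
  by exists 1; [exact: word_ball1|rewrite mulg1].
by exists l; [exact: Lr|].
Qed.

End WordBalls.

(** Almost invariance under right multiplication by a finite set: the form in which the boundary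
    condition is used from here on. *)
Lemma folner_fmul (R : realType) (G : groupType) (S : {fset G})
    (F : nat -> {fset G}) (L : {fset G}) (eta : R) :
  generates S -> folner R S F -> 0 < eta ->
  \forall n \near \oo, #|` fmul (F n) L|%:R <= (1 + eta) * #|` F n|%:R :> R.
Proof.
move=> genS [Fn0 Fcvg] eta0; have [r rL] := card_fmul_boundary genS L.
(* The successor keeps the divisor positive when [L] is empty. *)
have /cvgr0_norm_lt /(_ (eta / #|` L|.+1%:R)) := Fcvg r.
rewrite divr_gt0// => /(_ isT); apply: filterS => n.
have F0 : 0 < #|` F n|%:R :> R by rewrite ltr0n cardfs_gt0.
rewrite /boundary_ratio ger0_norm ?divr_ge0// ltr_pdivrMr// => bnd.
apply: (@le_trans _ _ (#|` F n| + #|` fset_set (boundary S r (F n))| * #|` L|)%N%:R).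
  by rewrite ler_nat.
rewrite natrD natrM mulrDl mul1r lerD2l.
have /le_trans : #|` fset_set (boundary S r (F n))|%:R * #|` L|%:R <=
  (eta / #|` L|.+1%:R * #|` F n|%:R) * #|` L|.+1%:R :> R.
  by apply: ler_pM => //; [exact: ltW|rewrite ler_nat].
by apply; rewrite mulrAC divfK.
Qed.

Section EntropyValue.
Variables (R : realType) (G : groupType) (A : finType).
Implicit Types (P : set (configuration G A)) (F : {fset G}).

Definition rate F P : R := ln #|patterns F P|%:R / #|` F|%:R.

(** A real number that mentions no Folner sequence; for nonempty shifts [entropy_nonempty]
    identifies it with the entropy. *)
Definition hent P : R := inf [set rate F P | F in [set F | F != fset0]].

Section Nonempty.
Variable P : set (configuration G A).
Hypothesis P0 : P !=set0.

Lemma rate_ge0 F : 0 <= rate F P.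
Proof. by rewrite divr_ge0// ln_patterns_ge0. Qed.

Let has_inf_rate : has_inf [set rate F P | F in [set F | F != fset0]].
Proof.
split.
  exists (rate [fset 1%g]%fset P); exists [fset 1%g]%fset => //=.
  by rewrite -cardfs_gt0 cardfs1.
by exists 0 => _ [F _ <-]; exact: rate_ge0.
Qed.

Lemma hent_le F : F != fset0 -> hent P <= rate F P.
Proof. by move=> F0; apply: ge_inf; [case: has_inf_rate|exists F]. Qed.

Lemma hent_ge c : (forall F, F != fset0 -> c <= rate F P) -> c <= hent P.
Proof.
by move=> cP; apply: lb_le_inf; [case: has_inf_rate|move=> _ [F F0 <-]; exact: cP].
Qed.

Lemma hent_lt t : hent P < t -> exists2 F, F != fset0 & rate F P < t.
Proof.
move=> Pt; have t0 : 0 < t - hent P by rewrite subr_gt0.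
have [_ [F F0 <-]] := inf_adherent t0 has_inf_rate.
by rewrite -/(hent P) addrC subrK; exists F.
Qed.

(** The infimum is nearly attained at some [F], and [ln_patterns_cover] compares [E = Fn n] with
    this [F]: the translates of [F] that straddle [E] are indexed by [(E L \ E) F^-1] with
    [L = F^-1 F], a set of small density in [E]. *)
Lemma rate_near_hent (S : {fset G}) (Fn : nat -> {fset G}) (eta : R) :
    invariant P -> generates S -> folner R S Fn -> 0 < eta ->
  \forall n \near \oo, rate (Fn n) P <= hent P + eta.
Proof.
move=> invP genS folF eta0.
have [|F F0 Frate] := @hent_lt (hent P + eta / 2); first by rewrite ltrDl divr_gt0.
pose a : R := ln #|A|%:R; have a0 : 0 <= a by rewrite ln_ge0// ler1n (alphabet_gt0 P0).
(* The summand 1 keeps [d] positive when the alphabet has a single letter. *)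
pose d := #|` F|%:R * a + 1; have d0 : 0 < d by rewrite ltr_wpDl// mulr_ge0.
pose L := fmul (finv F) F.
have L1 : 1%g \in L.
  have /fset0Pn[f fF] := F0.
  by apply/fmulP; exists f^-1%g, f; rewrite mem_finv invgK mulVg.
have kappa0 : 0 < eta / 2 / d by rewrite !divr_gt0.
have := folner_fmul L genS folF kappa0; apply: filterS => n FnL.
set E := Fn n in FnL *; have E0 : 0 < #|` E|%:R :> R.
  by have [Fn0 _] := folF; rewrite ltr0n cardfs_gt0 Fn0.
pose B := fmul (fmul E L `\` E)%fset (finv F).
have cov := @ln_patterns_cover R _ _ P invP P0 E F B F0.
have EEL : (E `<=` fmul E L)%fset by apply/fsubsetP; exact: fmul1.
rewrite /rate ler_pdivrMr// [eta in leRHS]splitr addrA; apply: (le_trans (cov _)) =>  [g u v uF vF guE gvE|].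
  rewrite /B -(mulgK v g) mem_fmul// ?mem_finv ?invgK// inE gvE/=.
  by rewrite -(mulVKg u v) mulgA mem_fmul// mem_fmul// mem_finv invgK.
have BE : #|` B|%:R <= eta / 2 / d * #|` E|%:R * #|` F|%:R.
  apply: (@le_trans _ _ (#|` (fmul E L `\` E)%fset| * #|` F|)%N%:R).
    by rewrite ler_nat -(card_finv F) card_fmul.
  rewrite natrM ler_wpM2r// cardfsDS// natrB ?fsubset_leq_card//.
  by rewrite lerBlDl -[X in X + _]mul1r -mulrDl.
rewrite mulrDl lerD//; first by rewrite mulrC ler_wpM2r// ltW.
rewrite (le_trans (ler_wpM2r a0 BE))//.
rewrite (_ : _ * a = eta / 2 * #|` E|%:R * ((#|` F|%:R * a) / d)); last by ring.
by rewrite ler_piMr ?mulr_ge0 ?divr_ge0 ?(ltW eta0)// ler_pdivrMr// mul1r lerDl.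
Qed.

End Nonempty.
End EntropyValue.

Section EntropyOfShift.
Variables (R : realType) (G : groupType) (S : {fset G}) (A : finType).
Hypotheses (genS : generates S) (amenG : amenable R S).
Implicit Type X : subshift G A.

Let entropy_unique X h : is_entropy S X h -> entropy R S X = h.
Proof.
move=> Xh; have [F folF] := amenG.
have ex : exists h, is_entropy (R := R) S X h by exists h.
have cv := getPex ex F folF; apply: cvg_unique cv (Xh _ folF).
exact: ereal_hausdorff.
Qed.

Lemma entropy_nonempty X : shift_set X !=set0 -> entropy R S X = (hent R X)%:E.
Proof.
move=> X0; apply: entropy_unique => F folF.
have -> : (fun n => pattern_rate R (F n) X) = (fun n => (rate R (F n) X)%:E).
  apply/funext => n; rewrite /pattern_rate /rate lne_EFin ?(patterns_gt0 _ X0)//.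
  by rewrite -EFinM mulrC.
apply: cvg_EFin; first by apply: nearW.
apply/cvgrPdist_le => eta eta0; have invX : invariant X by exact: shift_invariant.
have := rate_near_hent X0 invX genS folF eta0; apply: filterS => n le_n.
rewrite /= distrC ger0_norm ?subr_ge0 ?lerBlDl//.
by have [Fn0 _] := folF; exact: hent_le.
Qed.

(** Consequently every shift whose entropy is at least a real number is nonempty. *)
Lemma entropy_empty X : ~ (shift_set X !=set0) -> entropy R S X = -oo%E.
Proof.
move=> X0; apply: entropy_unique => F folF.
have -> : (fun n => pattern_rate R (F n) X) = (fun=> -oo%E); last exact: cvg_cst.
apply/funext => n; rewrite /pattern_rate.
have -> : #|patterns (F n) X| = 0%N.
  apply/eqP; rewrite cards_eq0; apply/eqP/setP => p; rewrite finset.in_set finset.in_set0.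
  by apply/asboolP => -[x Xx]; case: X0; exists x.
by rewrite le0_lneNy// gt0_muleNy// lte_fin invr_gt0 ltr0n cardfs_gt0; have [Fn0 _] := folF; exact: Fn0.
Qed.

End EntropyOfShift.

(** * Closures, shifts of finite type and limits *)

Lemma numbering (T : Type) : ([set: T] #= [set: nat])%card ->
  exists (f : T -> nat) (e : nat -> T), cancel f e /\ cancel e f.
Proof.
move=> /pcard_eqP[f]; have /choice[e fe] (n : nat) : exists x, f x = n.
  by have [x _ <-] := 'surj_f (I : setT n); exists x.
exists f, e; split=> // x; apply: 'inj_f; [exact: mem_set|exact: mem_set|exact: fe].
Qed.

Section Closure.
Variables (G : groupType) (A : finType).
Implicit Types (P Q : set (configuration G A)) (K M : {fset G}).

Lemma patterns_eqP K P Q : patterns K P = patterns K Q <->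
  (forall x, P x -> exists2 y, Q y & forall k, k \in K -> x k = y k) /\
  (forall x, Q x -> exists2 y, P y & forall k, k \in K -> x k = y k).
Proof.
split=> [PQ|[PQ QP]].
  by split=> x; apply: patterns_subset_ex; rewrite PQ.
by apply/eqP; rewrite finset.eqEsubset !patterns_subset.
Qed.

Lemma patterns_eq_sub K K' P Q : {subset K <= K'} ->
  patterns K' P = patterns K' Q -> patterns K P = patterns K Q.
Proof.
move=> KK' /patterns_eqP[PQ QP]; apply/patterns_eqP.
split=> x => [/PQ|/QP] [y Py xy]; exists y => // k kK; apply: xy; exact: KK'.
Qed.

Lemma patterns_nonempty K P Q : patterns K P = patterns K Q -> P !=set0 -> Q !=set0.
Proof. by move=> /patterns_eqP[PQ _] [x /PQ[y Qy _]]; exists y. Qed.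

(** The topological closure, expressed by finite windows so that it visibly has the same patterns as
    [P]. *)
Definition cl P : set (configuration G A) :=
  [set x | forall K, exists2 y, P y & forall k, k \in K -> x k = y k].

Lemma sub_cl P : P `<=` cl P.
Proof. by move=> x Px K; exists x. Qed.

Lemma closed_cl P : closed (cl P).
Proof.
move=> x clx K.
have /clx[y [Py xy]] : nbhs x [set y : configuration G A | forall k, k \in K -> x k = y k].
  apply/nbhsP; exists [set xy | forall k, k \in K -> xy.1 k = xy.2 k].
    exact: entourage_agree.
  by move=> y /xsectionP.
have [z Pz yz] := Py K; exists z => // k kK.
by rewrite xy// yz.
Qed.

Lemma invariant_cl P : invariant P -> invariant (cl P).
Proof.
move=> invP g x clx K; have [y Py xy] := clx (ftrans g^-1%g K).
exists (translate g y); first exact: invP.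
by move=> k kK; rewrite /translate xy// mem_ftrans invgK mulVKg.
Qed.

Definition closed_shift P (invP : invariant P) : subshift G A :=
  Subshift (@closed_cl P) (invariant_cl invP).

Lemma patterns_cl K P : patterns K (cl P) = patterns K P.
Proof.
by apply/patterns_eqP; split=> x; [apply|move=> Px; exists x => //; exact: sub_cl].
Qed.

(** For invariant [P], this is the shift of finite type whose allowed [M]-patterns are those of
    [P]. *)
Definition window_hull M P : set (configuration G A) :=
  [set x | forall g, exists2 y, P y & forall m, m \in M -> x (g * m)%g = y m].

Lemma invariant_window_hull M P : invariant (window_hull M P).
Proof.
move=> h x Px g; have [y Py xy] := Px (h^-1 * g)%g.
by exists y => // m mM; rewrite /translate mulgA xy.
Qed.

Lemma sub_window_hull M P : invariant P -> P `<=` window_hull M P.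
Proof.
move=> invP x Px g; exists (translate g^-1%g x); first exact: invP.
by move=> m _; rewrite /translate invgK.
Qed.

Lemma window_hull_agree M P x : window_hull M P x ->
  exists2 y, P y & forall m, m \in M -> x m = y m.
Proof. by move=> /(_ 1%g)[y Py xy]; exists y => // m /xy; rewrite mul1g. Qed.

Section Limit.
Variables (X : nat -> subshift G A) (K : nat -> {fset G}).
Hypotheses (K_mono : forall n, {subset K n <= K n.+1})
  (K_cover : forall g, exists n, g \in K n)
  (XK : forall n, patterns (K n) (X n.+1) = patterns (K n) (X n)).

Let K_le m n : (m <= n)%N -> {subset K m <= K n}.
Proof.
elim: n => [|n IHn]; first by rewrite leqn0 => /eqP->.
by rewrite leq_eqVlt => /predU1P[->//|/IHn mn] g /mn; exact: K_mono.
Qed.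

Lemma exhaust (F : {fset G}) : exists n, {subset F <= K n}.
Proof.
have [f fK] := choice K_cover; exists (\max_(g : F) f (val g)) => g gF.
apply: K_le (fK g); exact: (@leq_bigmax _ (fun g : F => f (val g)) [` gF]%fset).
Qed.

Let X_stable m n : (m <= n)%N -> patterns (K m) (X n) = patterns (K m) (X m).
Proof.
elim: n => [|n IHn]; first by rewrite leqn0 => /eqP->.
rewrite leq_eqVlt ltnS => /predU1P[->//|mn]; rewrite -IHn//.
exact: patterns_eq_sub (K_le mn) (XK n).
Qed.

(** The limit consists of the configurations all of whose [K n]-windows are seen in [X n], for every
    [n]. The point is that no pattern is lost: a pattern of [X n] is extended successively to points
    of [X n.+1], [X n.+2] and so on, which stabilise on larger and larger windows. *)
Lemma limit_shift : exists Y : subshift G A,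
  forall n, patterns (K n) Y = patterns (K n) (X n).
Proof.
pose Z := [set x : configuration G A | forall n g, exists2 y, shift_set (X n) y &
  forall k, k \in K n -> x (g * k)%g = y k].
have invZ : invariant Z.
  move=> h x Zx n g; have [y Xy xy] := Zx n (h^-1 * g)%g.
  by exists y => // m mM; rewrite /translate mulgA xy.
exists (closed_shift invZ) => n; rewrite patterns_cl; apply/patterns_eqP.
split=> [x Zx|y0 Xy0].
  by have [y Xy xy] := Zx n 1%g; exists y => // k /xy; rewrite mul1g.
have /choice[f fP] (my : nat * configuration G A) : exists y' : configuration G A,
    shift_set (X (n + my.1)%N) my.2 ->
    shift_set (X (n + my.1).+1) y' /\ forall k, k \in K (n + my.1)%N -> y' k = my.2 k.
  have [Xmy|] := pselect (shift_set (X (n + my.1)%N) my.2); last by exists my.2.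
  have /patterns_eqP[_ /(_ _ Xmy)[y' Xy' yy']] := XK (n + my.1)%N.
  by exists y' => _; split=> // k /yy'.
pose fix y m := if m is m'.+1 then f (m', y m') else y0.
have yX m : shift_set (X (n + m)%N) (y m).
  by elim: m => [|m IHm]; rewrite ?addn0// addnS; have [] := fP (m, y m) IHm.
have yS m j k : k \in K (n + m)%N -> y (m + j)%N k = y m k.
  move=> kK; elim: j => [|j IHj]; rewrite ?addn0// addnS /=.
  have [_ /= ->//] := fP (m + j, y (m + j))%N (yX _).
  by apply: K_le kK; rewrite leq_add2l leq_addr.
have /choice[mu muP] g : exists m, g \in K (n + m)%N.
  have [m gm] := K_cover g; exists m; apply: K_le gm; exact: leq_addl.
(* The diagonal configuration: each coordinate is read at a stage after which it no longer
   changes. *)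
pose x : configuration G A := fun g => y (mu g) g.
have xE m k : k \in K (n + m)%N -> x k = y m k.
  rewrite /x => kK; have [le|/ltnW le] := leqP m (mu k).
    by rewrite -(subnKC le) yS.
  by rewrite -(subnKC le) yS.
exists x; last by move=> k kK; rewrite (xE 0%N) ?addn0.
(* On the window [g K n'] the configuration [x] agrees with [y p] for large [p], and the
   [K n']-patterns of [X (n + p)] are those of [X n']. *)
move=> n' g; have [m Km] := exhaust (ftrans g (K n')).
pose p := maxn m n'.
have pn : (n' <= n + p)%N by rewrite (leq_trans (leq_maxr m n'))// leq_addl.
have inv : shift_set (X (n + p)%N) (translate g^-1%g (y p)) by exact: shift_invariant.
have /patterns_eqP[/(_ _ inv)[z Xz yz] _] := X_stable pn.
exists z => // k kK; rewrite -yz// /translate invgK (xE p)//.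
apply: (@K_le m); first by rewrite (leq_trans (leq_maxl m n'))// leq_addl.
by rewrite Km// mem_ftrans mulKg.
Qed.

End Limit.
End Closure.

(** * Tilings *)

(** Recursion along a rank: values at points of rank not below that of [t] are masked by [x0]. It
    serves both the greedy colouring and the greedy choice of markers. *)
Lemma rank_recursion (T X : Type) (x0 : X) (r : T -> nat) (Phi : T -> (T -> X) -> X) :
  exists phi, forall t, phi t = Phi t (fun s => if (r s < r t)%N then phi s else x0).
Proof.
pose psi := fix psi n t :=
  if n is m.+1 then Phi t (fun s => if (r s < r t)%N then psi m s else x0) else x0.
have psiE m n t : (r t < m)%N -> (r t < n)%N -> psi m t = psi n t.
  elim: m n t => [//|m IHm] [//|n] t /= tm tn; congr Phi; apply/funext => s.
  by case: ifP => // st; apply: IHm; exact: leq_trans st _.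
exists (fun t => psi (r t).+1 t) => t /=; congr Phi; apply/funext => s.
by case: ifP => // st; exact: (psiE (r t) (r s).+1).
Qed.

Section Markers.
Variables (G : groupType) (N : nat) (F : {fset G}).
Local Notation markers := (configuration G (option 'I_N)).
Implicit Types (chi : markers) (d g h : G).
Local Open Scope group_scope.

(* Overlaps are resolved by colours rather than by an enumeration of [G]: the
   colours are local data from a small set, so the tilings have small entropy. *)
Definition cell chi d h : Prop := d^-1 * h \in F /\ exists i, chi d = Some i /\
  forall d' j, d'^-1 * h \in F -> chi d' = Some j -> (i <= j)%N.

(** The first field makes the cells of distinct markers disjoint, the second bounds the density of
    markers by about [2 / |F|], and the third makes the cells cover about half of the group. *)
Record tiling chi : Prop := Tiling {
  tiling_color : forall d d' i h, chi d = Some i -> chi d' = Some i ->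
    d^-1 * h \in F -> d'^-1 * h \in F -> d = d' ;
  tiling_large : forall d, chi d != None ->
    (#|` F| <= 2 * #|` [fset u in F | `[< cell chi d (d * u) >]]%fset|)%N ;
  tiling_dense : forall g,
    (#|` F| <= 2 * #|` [fset u in F | `[< exists d, cell chi d (g * u) >]]%fset|)%N }.

Lemma cell_uniq chi d d' h : tiling chi -> cell chi d h -> cell chi d' h -> d = d'.
Proof.
move=> tchi [dh [i [di imin]]] [d'h [j [dj jmin]]].
have ij : i = j by apply/val_inj/anti_leq/andP; split; [exact: imin dj|exact: jmin di].
by apply: (tiling_color tchi di _ dh d'h); rewrite ij.
Qed.

Lemma cell_exists chi d h : chi d != None -> d^-1 * h \in F -> exists d', cell chi d' h.
Proof.
case di : (chi d) => [i|//] _ dh.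
pose P n := `[< exists d' j, [/\ chi d' = Some j, d'^-1 * h \in F & j = n :> nat] >].
have exP : exists n, P n by exists i; apply/asboolP; exists d, i.
case: (ex_minnP exP) => n /asboolP[d' [j [d'j d'h <-]]] jmin.
exists d'; split=> //; exists j; split=> // d1 j1 d1h d1j.
by apply: jmin; apply/asboolP; exists d1, j1.
Qed.

Lemma cell_translate chi g d h :
  cell (translate g chi) d h <-> cell chi (g^-1 * d) (g^-1 * h).
Proof.
rewrite /cell /translate invgM invgK -mulgA mulVKg.
split=> -[dh [i [di imin]]]; split=> //; exists i; split=> // d' j d'h d'j.
  by apply: (imin (g * d')); rewrite ?mulKg// invgM -mulgA.
by apply: (imin (g^-1 * d')); rewrite // invgM invgK -mulgA mulVKg.
Qed.

Lemma tiling_translate chi g : tiling chi -> tiling (translate g chi).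
Proof.
move=> tchi; split=> [d d' i h di d'i dh d'h|d dn|h].
- apply: (@mulgI _ g^-1); apply: (tiling_color tchi (h := g^-1 * h)) di d'i _ _.
    by rewrite invgM invgK -mulgA mulVKg.
  by rewrite invgM invgK -mulgA mulVKg.
- apply: leq_trans (tiling_large tchi dn) _; rewrite leq_mul2l/=.
  apply: fsubset_leq_card; apply/fsubsetP => u; rewrite !inE/= => /andP[-> /asboolP du].
  by apply/asboolP/cell_translate; rewrite mulgA.
- apply: leq_trans (tiling_dense tchi (g^-1 * h)) _; rewrite leq_mul2l/=.
  apply: fsubset_leq_card; apply/fsubsetP => u; rewrite !inE/= => /andP[-> /asboolP[d du]].
  by apply/asboolP; exists (g * d); apply/cell_translate; rewrite mulKg mulgA.
Qed.

End Markers.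

Section TilingExistence.
Variables (G : groupType) (F : {fset G}).
Hypothesis countG : ([set: G] #= [set: nat])%card.
Let N := (#|` F| * #|` F|).+1.
Local Open Scope group_scope.

(** Greedy colouring along an enumeration of the group: the elements in conflict with [g] lie in
    [g F F^-1], so [|F|^2 + 1] colours suffice. *)
Let coloring : exists c : G -> 'I_N, forall g h k,
  g != h -> g^-1 * k \in F -> h^-1 * k \in F -> c g != c h.
Proof.
have [code [num [codeK _]]] := numbering countG.
pose nb g := ftrans g (fmul F (finv F)).
have [c cP] := rank_recursion (ord0 : 'I_N) code (fun g phi =>
  odflt ord0 [pick i | i \notin [fset phi h | h in nb g]%fset]).
have cneq g h : h \in nb g -> (code h < code g)%N -> c g != c h.
  move=> hg chg; rewrite cP; case: pickP => [i /=|all_in].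
    by apply: contraNneq => ->; apply/imfsetP; exists h; rewrite //= chg.
  set U := imfset _ _ _ in all_in.
  have : (N <= #|` U|)%N.
    rewrite -[N in leqLHS]size_enum_ord; apply: uniq_leq_size (enum_uniq _) _ => i _.
    by have /negbFE := all_in i.
  rewrite leqNgt ltnS (leq_trans (leq_imfset_card _ _ _))//.
  by rewrite card_ftrans (leq_trans (card_fmul _ _))// card_finv.
exists c => g h k gh gk hk.
have nbP (g' h' : G) : g'^-1 * k \in F -> h'^-1 * k \in F -> h' \in nb g'.
  move=> g'k h'k; rewrite mem_ftrans; apply/fmulP; exists (g'^-1 * k), (k^-1 * h').
  by rewrite mem_finv invgM invgK -mulgA mulVKg.
have : code g != code h by apply: contraNneq gh => /(can_inj codeK)->.
rewrite neq_ltn => /orP[lt_gh|lt_hg]; last by apply: cneq => //; exact: nbP.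
by rewrite eq_sym; apply: cneq => //; exact: nbP.
Qed.

(** Going through the colours in increasing order, [g] is kept as a marker when at most half of
    [g F] is hit by translates of markers already kept. A kept marker retains at least half of its
    translate; a rejected [g] has more than half of [g F] covered. *)
Lemma tiling_exists : exists chi : configuration G (option 'I_N), tiling F chi.
Proof.
have [c cP] := coloring.
pose old (D : G -> bool) g := [fset u in F |
  `[< exists d, [/\ D d, (c d < c g)%N & d^-1 * (g * u) \in F] >]]%fset.
have [D0 D0P] := rank_recursion false c (fun g D => (2 * #|` old D g| <= #|` F|)%N).
(* The masking in the recursion is harmless because [old] already asks for [c d < c g]. *)
have DP g : D0 g = (2 * #|` old D0 g| <= #|` F|)%N.
  rewrite D0P; congr (2 * #|` _| <= _)%N; apply/fsetP => u; rewrite !inE /=.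
  congr (_ && _); apply: asbool_equiv_eq; split=> -[d [Dd dg du]]; exists d.
    by move: Dd; rewrite dg.
  by rewrite dg.
pose chi : configuration G (option 'I_N) := fun g => if D0 g then Some (c g) else None.
have chiP d i : chi d = Some i -> D0 d /\ c d = i.
  by rewrite /chi; case: ifP => // Dd [].
exists chi; split=> [d d' i h /chiP[_ di] /chiP[_ d'i] dh d'h|d|g].
- apply/eqP/negP => /negP dd'; have := cP _ _ _ dd' dh d'h.
  by rewrite di d'i eqxx.
- case di : (chi d) => [i|//] _; have [Dd cd] := chiP _ _ di.
  set C := [fset u in F | _]%fset.
  have FC : (F `\` old D0 d `<=` C)%fset.
    apply/fsubsetP => u; rewrite !inE /= negb_and => /andP[+ uF]; rewrite uF/= => du.
    apply/asboolP; split; first by rewrite mulKg.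
    exists i; split=> // d' j d'u /chiP[Dd' d'j]; rewrite leqNgt; apply: contra du => ji.
    by apply/asboolP; exists d'; rewrite cd d'j.
  have oldF : (old D0 d `<=` F)%fset by apply/fsubsetP => u; rewrite !inE => /andP[].
  have := fsubset_leq_card FC; rewrite cardfsDS// leq_subLR; move: Dd; rewrite DP.
  by move=> h1 h2; lia.
- have cover u : u \in F -> (D0 g \/ exists d, [/\ D0 d, (c d < c g)%N & d^-1 * (g * u) \in F]) ->
      u \in [fset u in F | `[< exists d, cell F chi d (g * u) >]]%fset.
    move=> uF mk; rewrite !inE uF /=; apply/asboolP.
    have [Dg|[d [Dd _ du]]] := mk.
      by apply: (@cell_exists _ _ _ _ g); rewrite /chi ?Dg ?mulKg.
    by apply: (@cell_exists _ _ _ _ d); rewrite /chi ?Dd.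
  have [Dg|Dg] := boolP (D0 g).
    rewrite (leq_trans (leq_pmull #|` F| (isT : 0 < 2)%N))// leq_mul2l/=.
    by apply: fsubset_leq_card; apply/fsubsetP => u uF; apply: cover => //; left.
  move: Dg; rewrite DP -ltnNge => /ltnW/leq_trans; apply; rewrite leq_mul2l/=.
  apply: fsubset_leq_card; apply/fsubsetP => u; rewrite !inE/= => /andP[uF /asboolP ex].
  by have := cover u uF (or_intror ex); rewrite !inE.
Qed.

End TilingExistence.

(** * Refilling the interiors of the tiles *)

Section Fillings.
Variables (G : groupType) (A : finType) (N : nat) (F B : {fset G}).
Variables (W : set (configuration G A)) (w0 : configuration G A).
Local Notation markers := (configuration G (option 'I_N)).
Implicit Types (chi : markers) (w x : configuration G A) (J : seq G) (d g h : G).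
Local Open Scope group_scope.

Definition interior_cell chi d h := forall b, b \in B -> cell F chi d (h * b).

Definition active chi J d h := interior_cell chi d h /\ d^-1 * h \in J.

(* Indexed by [d^-1 h] rather than by [h], so that the choice made by [xget]
   commutes with translations. *)
Definition filling chi J d w : configuration G A :=
  xget w0 [set y | W y /\ forall u, cell F chi d (d * u) ->
    ~ active chi J d (d * u) -> y u = w (d * u)].

Definition refilled chi J w x :=
  (forall h, (forall d, ~ active chi J d h) -> x h = w h) /\
  (forall d h, active chi J d h -> x h = filling chi J d w (d^-1 * h)).

Hypothesis B1 : 1 \in B.
Hypothesis invW : invariant W.

Lemma interior_cell_cell chi d h : interior_cell chi d h -> cell F chi d h.
Proof. by move=> /(_ 1 B1); rewrite mulg1. Qed.

Lemma active_cell chi J d h : active chi J d h -> cell F chi d h.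
Proof. by move=> [/interior_cell_cell]. Qed.

Lemma active_uniq chi J d d' h : tiling F chi ->
  active chi J d h -> active chi J d' h -> d = d'.
Proof. by move=> tchi /active_cell dh /active_cell; exact: cell_uniq. Qed.

Lemma filling_spec chi J d w : W w -> W (filling chi J d w) /\
  forall u, cell F chi d (d * u) -> ~ active chi J d (d * u) ->
    filling chi J d w u = w (d * u).
Proof.
move=> Ww; rewrite /filling; set P := [set y | _].
suff : P (xget w0 P) by [].
apply: xgetPex; exists (translate d^-1 w); split; first exact: invW.
by move=> u _ _; rewrite /translate invgK.
Qed.

Lemma refilled_exists chi J w : tiling F chi -> exists x, refilled chi J w x.
Proof.
move=> tchi.
have /choice[x xP] h : exists a, ((forall d, ~ active chi J d h) -> a = w h) /\
    forall d, active chi J d h -> a = filling chi J d w (d^-1 * h).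
  have [[d dh]|nex] := pselect (exists d, active chi J d h).
    exists (filling chi J d w (d^-1 * h)); split; first by move=> /(_ d).
    by move=> d' d'h; rewrite (active_uniq tchi dh d'h).
  by exists (w h); split=> // d dh; case: nex; exists d.
exists x; split=> [h nh|d h dh]; first exact: (xP h).1.
exact: (xP h).2.
Qed.

(** Since [M^-1 M] lies in [B], a window [g M] that meets the interior of a cell is contained in
    this cell, where [x] is a translate of the filling; any other window shows [w]. Both are allowed
    in [W]. *)
Lemma refilled_hull (M : {fset G}) (P : set (configuration G A)) chi J w x :
    W = window_hull M P ->
    (forall m m', m \in M -> m' \in M -> m^-1 * m' \in B) ->
  tiling F chi -> W w -> refilled chi J w x -> W x.
Proof.
move=> WE MB tchi Ww [xw xf]; rewrite WE => g.
have [[d [m0 m0M dm0]]|nint] := pselect (exists d, exists2 m, m \in M & interior_cell chi d (g * m)).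
  have [Wy yw] := filling_spec chi J d Ww; set y := filling _ _ _ _ in Wy yw.
  have : W (translate d y) by exact: invW.
  rewrite WE => /(_ g)[z Pz yz]; exists z => // m mM; rewrite -yz// /translate.
  have cm : cell F chi d (g * m).
    by have := dm0 _ (MB _ _ m0M mM); rewrite mulgA mulgK.
  have [act|nact] := pselect (active chi J d (g * m)); first by rewrite (xf d).
  rewrite xw => [|d' d'm]; first by rewrite yw ?mulVKg.
  by apply: nact; rewrite (cell_uniq tchi cm (active_cell d'm)).
move: Ww; rewrite WE => /(_ g)[z Pz wz]; exists z => // m mM.
by rewrite xw ?wz// => d [dm _]; apply: nint; exists d, m.
Qed.

Lemma interior_cell_translate chi g d h :
  interior_cell (translate g chi) d h <-> interior_cell chi (g^-1 * d) (g^-1 * h).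
Proof.
by split=> dh b /dh; [move=> /cell_translate|move=> ?; apply/cell_translate]; rewrite mulgA.
Qed.

Lemma active_translate chi J g d h :
  active (translate g chi) J d h <-> active chi J (g^-1 * d) (g^-1 * h).
Proof.
have e : (g^-1 * d)^-1 * (g^-1 * h) = d^-1 * h by rewrite invgM invgK -mulgA mulVKg.
by rewrite /active e; split=> -[dh uJ]; split=> //; apply/interior_cell_translate.
Qed.

Lemma filling_translate chi J g d w :
  filling (translate g chi) J d (translate g w) = filling chi J (g^-1 * d) w.
Proof.
rewrite /filling; congr xget; apply/seteqP; split=> y [Wy yw]; split=> // u du ndu.
  have -> : y u = translate g w (d * u); last by rewrite /translate mulgA.
  apply: yw; first by apply/(cell_translate F chi); rewrite mulgA.
  by move=> /(active_translate chi) a; apply: ndu; rewrite -mulgA.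
rewrite /translate mulgA; apply: yw; rewrite -mulgA; first exact/(cell_translate F chi).
by move=> a; apply: ndu; apply/(active_translate chi).
Qed.

Lemma refilled_translate chi J g w x :
  refilled chi J w x -> refilled (translate g chi) J (translate g w) (translate g x).
Proof.
move=> [xw xf]; split=> [h nh|d h /active_translate dh].
  rewrite /translate xw// => d dh; apply: (nh (g * d)); apply/active_translate.
  by rewrite mulKg.
by rewrite {1}/translate (xf _ _ dh) filling_translate invgM invgK -mulgA mulVKg.
Qed.

Section Locality.
Variable L : {fset G}.
Hypotheses (L1 : 1 \in L) (L2 : {subset fmul (finv F) F <= L})
  (L3 : {subset fmul (fmul (finv F) F) (finv F) <= L}).

(** Whether [d v] belongs to the cell of [d] is decided by the markers in [d v F^-1], and [d] lies
    in [h F^-1]; hence the set [F^-1 F F^-1] in the hypothesis on [L]. *)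
Lemma cell_local chi chi' d h v : cell F chi d h ->
    (forall l, l \in L -> chi (h * l) = chi' (h * l)) ->
  cell F chi d (d * v) <-> cell F chi' d (d * v).
Proof.
move=> [dh _] chichi'; pose u := d^-1 * h.
have near t : v \in F -> t \in F -> chi (d * v * t^-1) = chi' (d * v * t^-1).
  move=> vF tF; have -> : d * v * t^-1 = h * (u^-1 * v * t^-1).
    by rewrite /u invgM invgK -!mulgA mulVKg.
  by apply/chichi'/L3; rewrite !mem_fmul// mem_finv invgK.
have nearE d' : v \in F -> d'^-1 * (d * v) \in F -> chi d' = chi' d'.
  by move=> vF /(near _ vF); rewrite invgM invgK mulVKg.
rewrite /cell mulKg; split=> -[vF [i [di imin]]]; split=> //; exists i.
  split=> [|d' j d'v d'j]; first by rewrite -nearE ?mulKg.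
  by apply: (imin d') => //; rewrite nearE.
split=> [|d' j d'v d'j]; first by rewrite nearE ?mulKg.
by apply: (imin d') => //; rewrite -nearE.
Qed.

Lemma active_local chi chi' J d h v : cell F chi d h ->
    (forall l, l \in L -> chi (h * l) = chi' (h * l)) ->
  active chi J d (d * v) <-> active chi' J d (d * v).
Proof.
move=> dh chichi'; rewrite /active /interior_cell.
by split=> -[int vJ]; split=> // b bB; have := int b bB; rewrite -mulgA => /(cell_local _ dh chichi').
Qed.

(** At an active position, both fillings are chosen by [xget] from the same set, because this set
    depends only on the shape of the cell and on its inactive content. This is what makes the erased
    content recoverable without storing it. *)
Lemma refilled_local chi chi' J w w' x x' h :
    tiling F chi -> tiling F chi' -> refilled chi J w x -> refilled chi' J w' x' ->
    (forall l, l \in L -> chi (h * l) = chi' (h * l)) ->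
    (forall l, l \in L -> (forall d, ~ active chi J d (h * l)) -> w (h * l) = w' (h * l)) ->
  x h = x' h.
Proof.
move=> tchi tchi' [xw xf] [xw' xf'] chichi' ww'.
have [[d dh]|nex] := pselect (exists d, active chi J d h).
  have cdh := active_cell dh.
  have dh' : active chi' J d h.
    by rewrite -(mulVKg d h); apply/(active_local _ _ cdh chichi'); rewrite mulVKg.
  rewrite (xf _ _ dh) (xf' _ _ dh'); congr (_ _); rewrite /filling; congr xget.
  have ww2 u : cell F chi d (d * u) -> ~ active chi J d (d * u) -> w (d * u) = w' (d * u).
    move=> du ndu; have [dhF _] := cdh; have [uF _] := du; rewrite mulKg in uF.
    have e : d * u = h * ((d^-1 * h)^-1 * u) by rewrite invgM invgK -!mulgA mulVKg.
    rewrite e; apply: ww'; first by apply: L2; rewrite mem_fmul// mem_finv invgK.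
    rewrite -e => d' d'u; apply: ndu.
    by have := d'u; rewrite -(cell_uniq tchi du (active_cell d'u)).
  have cE u := cell_local u cdh chichi'.
  have aE u := active_local J u cdh chichi'.
  apply/seteqP; split=> y [Wy yw]; split=> // u du ndu.
    have [du' ndu'] : cell F chi d (d * u) /\ ~ active chi J d (d * u).
      by split=> [|a]; [exact/cE|apply: ndu; exact/aE].
    by rewrite yw// ww2.
  rewrite ww2//; apply: yw => [|a]; first exact/cE.
  by apply: ndu; exact/aE.
rewrite xw => [|d dh]; last by apply: nex; exists d.
rewrite xw' => [|d dh].
  by rewrite -[h]mulg1; apply: ww' => // d; rewrite mulg1 => dh; apply: nex; exists d.
apply: nex; exists d; rewrite -(mulVKg d h).
by apply/(active_local J _ (active_cell dh) (fun l lL => esym (chichi' l lL))); rewrite mulVKg.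
Qed.

End Locality.
End Fillings.

Lemma card_fset_sum (T : choiceType) (E : {fset T}) (p : pred T) :
  #|` [fset x in E | p x]%fset| = (\sum_(x <- E) p x)%N.
Proof.
have -> : #|` [fset x in E | p x]%fset| = size [seq x <- E | p x].
  apply/perm_size/uniq_perm; rewrite ?filter_uniq ?fset_uniq// => x.
  by rewrite mem_filter !inE andbC.
by rewrite size_filter -sum1_count big_mkcond; apply: eq_bigr => x _; case: (p x).
Qed.

Lemma double_count (T T' : choiceType) (E : {fset T}) (E' : {fset T'})
    (r : T -> T' -> bool) (k a b : nat) :
    (forall x, x \in E -> (a <= k * #|` [fset y in E' | r x y]%fset|)%N) ->
    (forall y, y \in E' -> (#|` [fset x in E | r x y]%fset| <= b)%N) ->
  (#|` E| * a <= k * (#|` E'| * b))%N.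
Proof.
move=> ra rb; apply: (@leq_trans (\sum_(x <- E) k * #|` [fset y in E' | r x y]%fset|)).
  rewrite card_fset_sum1 big_distrl/= big_seq [leqRHS]big_seq.
  by apply: leq_sum => x xE; rewrite mul1n ra.
rewrite -big_distrr/= leq_mul2l; apply/orP; right.
under eq_bigr do rewrite card_fset_sum.
rewrite exchange_big/= card_fset_sum1 big_distrl/= big_seq [leqRHS]big_seq.
by apply: leq_sum => y yE'; rewrite mul1n -card_fset_sum rb.
Qed.

(** * Densities of markers, covered cells and tile boundaries *)

Section Density.
Variables (G : groupType) (N : nat) (F : {fset G}).
Variable chi : configuration G (option 'I_N).
Hypothesis tchi : tiling F chi.
Implicit Types (H E C : {fset G}) (d g h : G).
Local Open Scope group_scope.

Definition support (I : finType) (x : configuration G (option I)) H : {fset G} :=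
  [fset h in H | x h != None]%fset.

Lemma cell_marked d h : cell F chi d h -> chi d != None.
Proof. by move=> [_ [i [-> _]]]. Qed.

(** Each marker in [H] owns at least [|F| / 2] cells of [H F], and no cell has two owners. *)
Lemma card_support H : (#|` support chi H| * #|` F| <= 2 * #|` fmul H F|)%N.
Proof.
rewrite -[#|` fmul H F|]muln1.
apply: (double_count (r := fun d h => `[< cell F chi d h >])).
  move=> d; rewrite !inE => /andP[dH dn]; apply: leq_trans (tiling_large tchi dn) _.
  rewrite leq_mul2l/=; apply: (leq_card_inj (f := fun u => d * u)) => [? ? _ _ /mulgI//|u].
  by rewrite !inE/= => /andP[uF ->]; rewrite mem_fmul.
move=> h _; set X := imfset _ _ _; have [->|/fset0Pn[d]] := eqVneq X fset0.
  by rewrite cardfs0.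
rewrite !inE => /andP[_ /asboolP dh]; rewrite -(cardfs1 d).
apply/fsubset_leq_card/fsubsetP => d'; rewrite !inE => /andP[_ /asboolP d'h].
by rewrite (cell_uniq tchi d'h dh).
Qed.

(** Averaging [tiling_dense] over the translates [g F] with [g] in [E]; a point lies in at most
    [|F|] of them. *)
Lemma card_covered E : F != fset0 ->
  (#|` E| <= 2 * #|` [fset h in fmul E F | `[< exists d, cell F chi d h >]]%fset|)%N.
Proof.
move=> F0; rewrite -(leq_pmul2r (_ : 0 < #|` F|)%N) ?cardfs_gt0// -mulnA.
apply: (double_count (r := fun g h => g^-1 * h \in F)).
  move=> g gE; apply: leq_trans (tiling_dense tchi g) _.
  rewrite leq_mul2l/=; apply: (leq_card_inj (f := fun u => g * u)) => [? ? _ _ /mulgI//|u].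
  by rewrite !inE/= => /andP[uF ->]; rewrite mem_fmul//= mulKg.
move=> h _; apply: (leq_card_inj (f := fun g => g^-1 * h)) => [? ? _ _ /mulIg/invg_inj//|g].
by rewrite !inE => /andP[].
Qed.

Variable C : {fset G}.
Hypotheses (C1 : 1 \in C) (CV : forall c, c \in C -> c^-1 \in C).

(** Boundaries of the full translates [d F], not of the cells, so that their size is controlled by
    the invariance of [F] alone. *)
Definition tile_boundary H : {fset G} := [fset h in H | `[< exists d b,
  [/\ chi d != None, b \in C & (d^-1 * h \in F) != (d^-1 * (h * b) \in F)] >]]%fset.

(** Leaving a cell means leaving [d F] or entering a translate [d' F] of smaller colour; either way
    the boundary of a full translate is crossed. *)
Lemma cell_tile_boundary H d h b : h \in H -> b \in C ->
  cell F chi d h -> ~ cell F chi d (h * b) -> h \in tile_boundary H.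
Proof.
move=> hH bC dh ndhb; rewrite !inE hH /=; apply/asboolP.
have [dF|dF] := boolP (d^-1 * (h * b) \in F); last first.
  by exists d, b; split=> //; [exact: cell_marked dh|rewrite dh.1 (negbTE dF)].
have [_ [i [di imin]]] := dh; apply: contrapT => nex; apply: ndhb.
split=> //; exists i; split=> // d' j d'F d'j; apply: (imin d') => //.
apply: contrapT => /negP d'h; apply: nex; exists d', b; split=> //; first by rewrite d'j.
by rewrite d'F (negbTE d'h).
Qed.

(** The boundary cells lie in [D dF C], where [D] is the set of markers within reach, counted by
    [card_support], and [dF = (F C \ F) C]. *)
Lemma card_tile_boundary H : (#|` tile_boundary H| * #|` F| <=
  2 * #|` fmul (fmul (fmul H C) (finv F)) F| * ((#|` fmul F C| - #|` F|) * #|` C| * #|` C|))%N.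
Proof.
pose dF := fmul (fmul F C `\` F)%fset C.
have FC : (F `<=` fmul F C)%fset by apply/fsubsetP; exact: fmul1.
have card_dF : (#|` dF| <= (#|` fmul F C| - #|` F|) * #|` C|)%N.
  by rewrite (leq_trans (card_fmul _ _))// cardfsDS.
pose D := support chi (fmul (fmul H C) (finv F)).
have sub : {subset tile_boundary H <= fmul (fmul D dF) C}.
  move=> h; rewrite !inE => /andP[hH /asboolP[d [b [dn bC]]]].
  have [dhF|ndhF] := boolP (d^-1 * h \in F); have [dhbF|ndhbF] := boolP (d^-1 * (h * b) \in F) => // _.
    apply/fmulP; exists h, 1; rewrite mulg1; split=> //.
    rewrite -(mulVKg d h); apply: mem_fmul.
      rewrite !inE dn andbT -(mulgK h d) -mulgA; apply/fmulP; exists h, (h^-1 * d).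
      rewrite mem_finv invgM invgK dhF mulVKg mulgA mulgK; split=> //.
      by rewrite -[h]mulg1 mem_fmul.
    rewrite -(mulgK b (d^-1 * h)) mem_fmul ?CV// inE -mulgA ndhbF/=.
    by rewrite mulgA mem_fmul.
  apply/fmulP; exists (h * b), b^-1; rewrite mulgK CV//; split=> //.
  rewrite -(mulVKg d (h * b)); apply: mem_fmul.
    rewrite !inE dn andbT; apply/fmulP; exists (h * b), ((h * b)^-1 * d).
    by rewrite mem_finv invgM invgK dhbF mulVKg mem_fmul.
  rewrite -(mulgVK b (d^-1 * (h * b))) mem_fmul// inE mem_fmul ?CV// andbT.
  by rewrite -!mulgA mulgV mulg1.
have leB : (#|` tile_boundary H| <= #|` D| * (#|` dF| * #|` C|))%N.
  have /fsubsetP/fsubset_leq_card/leq_trans := sub; apply.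
  by rewrite mulnA (leq_trans (card_fmul _ _))// leq_mul2r card_fmul orbT.
apply: (@leq_trans ((#|` D| * #|` F|) * (#|` dF| * #|` C|))%N).
  by rewrite mulnAC leq_mul2r leB orbT.
apply: leq_mul; first exact: card_support.
by rewrite leq_mul2r card_dF orbT.
Qed.

End Density.

(** * Counting sparsely marked configurations *)

Section Sparse.
Variable R : realType.

(** A generating-function bound: giving each marked site the weight [s^-1], an admissible map has
    weight at least [s^-m], while the total weight of all maps factorises over the sites. *)
Lemma card_sparse (V I : finType) (m : nat) (s : R) : 1 <= s ->
  #|[set f : {ffun V -> option I} | (#|[set v | f v != None]%SET| <= m)%N]%SET|%:R
    <= s ^+ m * (1 + #|I|%:R / s) ^+ #|V|.
Proof.
move=> s1; have s0 : 0 < s by exact: lt_le_trans s1.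
pose phi (o : option I) : R := if o is Some _ then s^-1 else 1.
have phi0 o : 0 <= phi o by case: o => [a|]; rewrite /phi ?invr_ge0 ?ltW.
have -> : (1 + #|I|%:R / s) ^+ #|V| = \sum_(f : {ffun V -> option I}) \prod_v phi (f v).
  rewrite -(bigA_distr_bigA (fun _ : V => phi)) prodr_const; congr (_ ^+ _).
  rewrite (bigD1 None)//= (eq_bigr (fun=> s^-1)) => [|[]//].
  by rewrite sumr_const cardC1 card_option -[in RHS]mulr_natl.
rewrite mulr_sumr -sum1_card natr_sum big_mkcond/=; apply: ler_sum => f _.
case: ifPn => [|_]; last first.
  by rewrite mulr_ge0 ?exprn_ge0 ?(ltW s0)// prodr_ge0// => v _; exact: phi0.
rewrite inE => fm; rewrite (bigID (fun v => f v == None))/= big1 => [|v /eqP->//].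
rewrite mul1r (eq_bigr (fun=> s^-1)) => [|v]; last by case: (f v).
rewrite prodr_const exprVn -(_ : #|[set v | f v != None]%SET| = #|[pred v | f v != None]|).
  rewrite ler_pdivlMr ?exprn_gt0// mul1r.
  exact: ler_weXn2l.
by rewrite cardsE.
Qed.

Lemma ln_patterns_sparse (G : groupType) (I : finType)
    (P : set (configuration G (option I))) (H : {fset G}) (m : nat) (s : R) :
    P !=set0 -> (forall x, P x -> (#|` support x H| <= m)%N) -> 1 <= s ->
  ln #|patterns H P|%:R <= m%:R * ln s + #|` H|%:R * (#|I|%:R / s) :> R.
Proof.
move=> P0 Pm s1; have s0 : 0 < s by exact: lt_le_trans s1.
have Is0 : 0 <= #|I|%:R / s by rewrite divr_ge0// ltW.
have : #|patterns H P|%:R <= s ^+ m * (1 + #|I|%:R / s) ^+ #|` H|.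
  rewrite cardfE; apply: le_trans (card_sparse _ _ _ s1).
  rewrite ler_nat; apply/subset_leq_card/fintype.subsetP => p.
  rewrite !finset.in_set => /asboolP[x Px <-]; apply: leq_trans (Pm x Px).
  rewrite (_ : [set v | _]%SET = [set v : H | x (val v) != None]%SET).
    by rewrite (card_fset_pred H (fun h => x h != None)).
  by apply/setP => v; rewrite !inE ffunE.
have b0 : 0 < 1 + #|I|%:R / s by rewrite ltr_pwDl.
move=> le_card; have {le_card} : ln #|patterns H P|%:R <= ln (s ^+ m * (1 + #|I|%:R / s) ^+ #|` H|).
  by rewrite ler_ln ?posrE ?(patterns_gt0 _ P0)// mulr_gt0 ?exprn_gt0.
move=> /le_trans; apply; rewrite lnM ?posrE ?exprn_gt0// !lnXn//.
rewrite [X in _ <= X + _]mulr_natl lerD2l -[leLHS]mulr_natl ler_wpM2l// le_ln1Dx//.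
by rewrite (lt_le_trans _ Is0)// ltrN10.
Qed.

End Sparse.

Lemma leq_patterns_cat (G : groupType) (A : finType) (P : set (configuration G A))
    (E H : {fset G}) : {subset E <= H} ->
  (#|patterns H P| <= #|patterns E P| * #|A| ^ (#|` H| - #|` E|))%N.
Proof.
move=> EH; have EH' : (E `<=` H)%fset by exact/fsubsetP.
apply: (@leq_trans (#|patterns E P| * #|patterns (H `\` E)%fset P|)%N); last first.
  by rewrite leq_mul2l -cardfsDS// leq_patterns_max orbT.
apply: leq_trans (nimg_pair _ _ _); rewrite patternsE.
apply: (nimg_le (rel := eq)) => [x Px|x x' _ _ _ _ <- <- [] /restrictionP xE /restrictionP xH].
  by exists x.
apply/restrictionP => k kH; have [kE|kE] := boolP (k \in E); first exact: xE.
by apply: xH; rewrite inE kE kH.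
Qed.

(** * Cells outside the interiors of the tiles *)

Section Uncovered.
Variables (R : realType) (G : groupType) (A : finType) (N : nat) (F B C F0 : {fset G}).
Variable chi : configuration G (option 'I_N).
Hypotheses (tchi : tiling F chi) (Fn0 : F != fset0) (F0n0 : F0 != fset0).
Hypotheses (B1 : 1%g \in B) (C1 : 1%g \in C) (CV : forall c, c \in C -> c^-1%g \in C)
  (BC : {subset B <= C})
  (FBC : forall u v b, u \in F0 -> v \in F0 -> b \in B -> (v^-1 * u * b)%g \in C).
Variables (E H : {fset G}).
Local Open Scope group_scope.

Definition uncovered : {fset G} :=
  [fset h in H | `[< forall d, ~ interior_cell F B chi d h >]]%fset.

Let not_interior d h : ~ interior_cell F B chi d h ->
  exists2 b, b \in B & ~ cell F chi d (h * b).
Proof.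
move=> nint; apply: contrapT => nex; apply: nint => b bB.
by apply: contrapT => nb; apply: nex; exists b.
Qed.

(** A covered cell of [H] is interior to its tile or belongs to [tile_boundary], so [card_covered]
    applies. *)
Lemma card_uncovered : {subset fmul E F <= H} ->
  (2 * #|` uncovered| + #|` E| <= 2 * #|` H| + 2 * #|` tile_boundary F chi C H|)%N.
Proof.
move=> EFH; have := card_covered tchi E Fn0; set T := imfset _ _ _ => ET.
have UH : (uncovered `<=` H)%fset by apply/fsubsetP => h; rewrite !inE => /andP[].
have TU : (T `<=` (H `\` uncovered) `|` tile_boundary F chi C H)%fset.
  apply/fsubsetP => h hT.
  have /andP[/EFH hH /asboolP[d dh]] :
    (h \in fmul E F) && `[< exists d, cell F chi d h >] by move: hT; rewrite !inE.
  rewrite in_fsetU; apply/orP; have [int|nint] := pselect (interior_cell F B chi d h).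
    by left; rewrite !inE hH/= andbT; apply/negP => /asboolP/(_ d).
  right; have [b bB ndh] := not_interior nint.
  exact: cell_tile_boundary hH (BC bB) dh ndh.
have := leq_trans (fsubset_leq_card TU) (leq_card_fsetU _ _); rewrite cardfsDS//.
have := fsubset_leq_card UH; move: ET; clear; lia.
Qed.

(** The uncovered cells are almost invariant: if [g u] is uncovered and [g v] is not, then [g v] is
    outside [H], or it is interior to a tile that is left by a step in [C]. Thus [ln_patterns_cover]
    applies with few bad translates. *)
Lemma ln_patterns_uncovered (W : set (configuration G A)) : invariant W -> W !=set0 ->
  ln #|patterns uncovered W|%:R <= #|` uncovered|%:R * rate R F0 W +
    ((#|` fmul H C| - #|` H| + #|` tile_boundary F chi C H|) * #|` F0|)%N%:R * ln #|A|%:R :> R.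
Proof.
move=> invW W0; pose D := fmul (fmul H C `\` H `|` tile_boundary F chi C H)%fset (finv F0).
have HC : (H `<=` fmul H C)%fset by apply/fsubsetP; exact: fmul1.
have B1C u v : u \in F0 -> v \in F0 -> v^-1 * u \in C.
  by move=> uF vF; rewrite -[v^-1 * u]mulg1 FBC.
apply: le_trans (@ln_patterns_cover R _ _ W invW W0 uncovered F0 D F0n0 _) _.
  move=> g u v uF vF; rewrite !inE/= => /andP[guH /asboolP gu]; rewrite negb_and => gv.
  rewrite -(mulgK v g) mem_fmul// ?mem_finv ?invgK// in_fsetU.
  have [gvH|gvH] := boolP (g * v \in H); last first.
    apply/orP; left; rewrite inE gvH/= -(mulVKg u v) mulgA mem_fmul//.
    exact: B1C.
  apply/orP; right; move: gv; rewrite gvH/= => /asboolPn/existsNP[d /contrapT dv].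
  have [b bB ndh] := not_interior (gu d).
  apply: (cell_tile_boundary (d := d) (b := v^-1 * u * b)) => //; first exact: FBC.
    exact: interior_cell_cell dv.
  by rewrite -!mulgA mulVKg mulgA.
rewrite lerD2l ler_wpM2r// ?ln_ge0 ?ler1n ?(alphabet_gt0 W0)// ler_nat.
rewrite (leq_trans (card_fmul _ _))// card_finv leq_mul2r; apply/orP; right.
by rewrite (leq_trans (leq_card_fsetU _ _))// cardfsDS.
Qed.

End Uncovered.

Section Refills.
Variables (G : groupType) (A : finType) (N : nat) (F B M L : {fset G}).
Variables (P : set (configuration G A)) (w0 : configuration G A).
Local Notation markers := (configuration G (option 'I_N)).
Local Notation config := (configuration G A).
Implicit Types (chi : markers) (w x : config) (J : seq G) (d g h : G) (E : {fset G}).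
Local Open Scope group_scope.

Let W := window_hull M P.
Let invW : invariant W := @invariant_window_hull _ _ M P.

Definition tilings : set markers := tiling F.

(** All tilings are allowed at once; a single fixed tiling would not give an invariant set. *)
Definition refills J : set config :=
  [set x | exists chi w, [/\ tiling F chi, W w & refilled F B W w0 chi J w x]].

Lemma invariant_refills J : invariant (refills J).
Proof.
move=> g x [chi [w [tchi Ww xw]]]; exists (translate g chi), (translate g w).
by split; [exact: tiling_translate|exact: invW|exact: refilled_translate].
Qed.

Hypothesis B1 : 1 \in B.
Hypothesis MB : forall m m', m \in M -> m' \in M -> m^-1 * m' \in B.

Lemma refills_hull J : refills J `<=` W.
Proof.
move=> x [chi [w [tchi Ww xw]]].
exact: (refilled_hull B1 invW erefl MB tchi Ww xw).
Qed.

Lemma hull_refills_nil : tilings !=set0 -> W `<=` refills [::].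
Proof.
move=> [chi tchi] w Ww; exists chi, w; split=> //; split=> // d h [_].
by rewrite in_nil.
Qed.

Lemma refills_agree J chi (K : {fset G}) w : tiling F chi ->
    (forall k d, k \in K -> ~ interior_cell F B chi d k) -> W w ->
  exists2 x, refills J x & forall k, k \in K -> w k = x k.
Proof.
move=> tchi avoid Ww; have [x xw] := refilled_exists W w0 B1 J w tchi.
exists x; first by exists chi, w.
by move=> k kK; rewrite xw.1// => d [/avoid].
Qed.

Hypotheses (L1 : 1 \in L) (L2 : {subset fmul (finv F) F <= L})
  (L3 : {subset fmul (fmul (finv F) F) (finv F) <= L}).

(** The content of position [f] of every translate [d F] with [d] a marker: a configuration as
    sparse as the markers. *)
Definition trace f chi w : configuration G (option A) :=
  fun h => if chi (h * f^-1) == None then None else Some (w h).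

Definition traces f : set (configuration G (option A)) :=
  [set t | exists chi w, tiling F chi /\ t = trace f chi w].

(* Passing from [J] to [f :: J] forgets at most one cell per tile. *)
Lemma leq_refills_cons J f E :
  (#|patterns E (refills J)| <= #|patterns (fmul (fmul E L) L) tilings| *
    (#|patterns (fmul E L) (traces f)| * #|patterns (fmul E L) (refills (f :: J))|))%N.
Proof.
set H := fmul E L; pose Q := [set q : markers * config * config * config |
  [/\ tiling F q.1.1.1, W q.1.1.2, refilled F B W w0 q.1.1.1 J q.1.1.2 q.1.2 &
      refilled F B W w0 q.1.1.1 (f :: J) q.1.1.2 q.2]].
pose phi (q : markers * config * config * config) := restriction (fmul H L) q.1.1.1.
pose psi (q : markers * config * config * config) := restriction H (trace f q.1.1.1 q.1.1.2).
pose rho (q : markers * config * config * config) := restriction H q.2.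
apply: (@leq_trans (nimg (fun q => (phi q, (psi q, rho q))) Q)); last first.
  apply: leq_trans (nimg_pair _ _ _) _; apply: leq_mul; last first.
    apply: leq_trans (nimg_pair _ _ _) _; apply: leq_mul.
      apply: (nimg_le (rel := fun q t => t = trace f q.1.1.1 q.1.1.2)) => [q [tq _ _ _]|].
        by eexists; last reflexivity; exists q.1.1.1, q.1.1.2.
      by move=> q q' _ _ _ _ -> ->.
    apply: (nimg_le (rel := fun q x => x = q.2)) => [q [tq Wq _ rq]|].
      by exists q.2 => //; exists q.1.1.1, q.1.1.2.
    by move=> q q' _ _ _ _ -> ->.
  apply: (nimg_le (rel := fun (q : markers * config * config * config) (x : markers) => x = q.1.1.1)) => [q [tq _ _ _]|].
    by exists q.1.1.1.
  by move=> q q' _ _ _ _ -> ->.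
apply: (nimg_le (rel := fun x q => Q q /\ q.1.2 = x)) => [x [chi [w [tchi Ww xw]]]|].
  have [x' x'w] := refilled_exists W w0 B1 (f :: J) w tchi.
  by exists (chi, w, x, x').
move=> _ _ [[[chi w] x] x'] [[[chi2 w2] x2] x2'] _ _ [[/= tchi _ xw x'w] <-] [[/= tchi2 _ xw2 x'w2] <-] [/restrictionP chiE /restrictionP tE /restrictionP x'E].
apply/restrictionP => h hE.
have chi_chi2 k : k \in H -> forall l, l \in L -> chi (k * l) = chi2 (k * l).
  by move=> kH l lL; apply: chiE; exact: mem_fmul.
have hH l : l \in L -> h * l \in H by move=> lL; exact: mem_fmul.
apply: (refilled_local B1 L1 L2 L3 tchi tchi2 xw xw2) => l lL.
  by rewrite -[h * l]mulg1 chi_chi2// hH.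
move: (h * l) (hH l lL) => k kH nact.
(* A position active for [f :: J] but not for [J] is position [f] of its tile and is read off the
   trace; any other position inactive for [J] still shows [w] in [x']. *)
have [[d dk]|nact'] := pselect (exists d, active F B chi (f :: J) d k).
  have df : d^-1 * k = f.
    have [int] := dk; rewrite inE => /predU1P[//|dJ].
    by case: (nact d).
  have := tE k kH; rewrite /trace (_ : k * f^-1 = d); last first.
    by rewrite -df invgM invgK mulVKg.
  have /negbTE -> := cell_marked (active_cell B1 dk).
  by case: ifP => // _ [].
have nact2 d : ~ active F B chi2 (f :: J) d k.
  move=> dk; apply: nact'; exists d; rewrite -(mulVKg d k).
  have chi2_chi l' : l' \in L -> chi2 (k * l') = chi (k * l') by move=> l'L; rewrite chi_chi2.
  apply/(active_local B L3 (f :: J) (d^-1 * k) (active_cell B1 dk) chi2_chi).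
  by rewrite mulVKg.
rewrite -x'w.1 => [|d dk]; last by apply: nact'; exists d.
by rewrite -x'w2.1//; exact: (x'E k kH).
Qed.

(** All interior positions are active, so given the markers the result depends only on [w] at the
    uncovered cells. The tiling returned maximises the number of patterns there, which bounds the
    fibres over all marker patterns uniformly. *)
Lemma leq_refills_full J E : {subset F <= J} -> tilings !=set0 ->
  exists2 chi : markers, tiling F chi &
  (#|patterns E (refills J)| <= #|patterns (fmul (fmul E L) L) tilings| *
    #|patterns (uncovered F B chi (fmul E L)) W|)%N.
Proof.
move=> FJ [chi0 tchi0]; set H := fmul E L.
pose p n := `[< exists2 chi : markers, tiling F chi & n = #|patterns (uncovered F B chi H) W| >].
have exp : exists n, p n by eexists; apply/asboolP; exists chi0.
have maxp n : p n -> (n <= #|A| ^ #|` H|)%N.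
  move=> /asboolP[chi _ ->]; apply: leq_trans (leq_patterns_max H W).
  by apply: leq_patternsS => h; rewrite !inE => /andP[].
case: (ex_maxnP exp maxp) => n /asboolP[chi1 tchi1 ->] nmax; exists chi1 => //.
pose Q := [set q : markers * config * config |
  [/\ tiling F q.1.1, W q.1.2 & refilled F B W w0 q.1.1 J q.1.2 q.2]].
pose phi (q : markers * config * config) := restriction (fmul H L) q.1.1.
apply: (@leq_trans (nimg phi Q * #|patterns (uncovered F B chi1 H) W|)); last first.
  rewrite leq_mul2r; apply/orP; right.
  apply: (nimg_le (rel := fun (q : markers * config * config) (x : markers) => x = q.1.1)) => [q [tq _ _]|]; first by exists q.1.1.
  by move=> q q' _ _ _ _ -> ->.
apply: (@leq_trans (nimg (fun q => restriction E q.2) Q)).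
  apply: (nimg_le (rel := fun x q => q.2 = x)) => [x [chi [w [tchi Ww xw]]]|].
    by exists (chi, w, x).
  by move=> _ _ q q' _ _ <- <-.
apply: nimg_fiber => -[[chi w] x] [tchi Ww xw].
apply: leq_trans (nmax #|patterns (uncovered F B chi H) W| _); last by apply/asboolP; exists chi.
apply: (nimg_le (rel := fun q y => y = q.1.2)) => [q [[_ Wq _] _]|]; first by exists q.1.2.
move=> [[chi2 w2] x2] [[chi3 w3] x3] _ _ [[/= tchi2 _ xw2] /restrictionP chi2E]
  [[/= tchi3 _ xw3] /restrictionP chi3E] -> -> /restrictionP /= wE.
apply/restrictionP => h hE.
have chi2_chi k : k \in H -> forall l, l \in L -> chi2 (k * l) = chi (k * l).
  by move=> kH l lL; apply: chi2E; exact: mem_fmul.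
apply: (refilled_local B1 L1 L2 L3 tchi2 tchi3 xw2 xw3) => l lL.
  have hl : h * l \in H by exact: mem_fmul.
  by rewrite -[h * l]mulg1 chi2_chi//; apply/esym/chi3E; exact: mem_fmul.
have hl : h * l \in H by exact: mem_fmul.
move=> nact; apply: wE; rewrite !inE hl/=; apply/asboolP => d dh.
apply: (nact d); rewrite -(mulVKg d (h * l)).
have [uF _] := interior_cell_cell B1 dh.
apply/(active_local B L3 J (d^-1 * (h * l)) (interior_cell_cell B1 dh)
  (fun l' l'L => esym (chi2_chi _ hl l' l'L))).
by rewrite mulVKg; split=> //; exact: FJ.
Qed.

End Refills.

(** * Entropy estimates *)

Section MarkerEntropy.
Variables (R : realType) (G : groupType).
Implicit Types (F H : {fset G}).

Lemma ln_patterns_markers (I : finType) (P : set (configuration G (option I)))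
    H (k b : nat) (s : R) :
    P !=set0 -> (0 < k)%N -> 1 <= s ->
    (forall x, P x -> (#|` support x H| * k <= 2 * b)%N) ->
  ln #|patterns H P|%:R <= 2 * b%:R / k%:R * ln s + #|` H|%:R * (#|I|%:R / s) :> R.
Proof.
move=> P0 k0 s1 Pb.
apply: (le_trans (ln_patterns_sparse (m := ((2 * b) %/ k)%N) P0 _ s1)) => [x Px|].
  by rewrite leq_divRL// Pb.
rewrite lerD2r ler_wpM2r ?ln_ge0//.
by rewrite ler_pdivlMr ?ltr0n// -!natrM ler_nat leq_trunc_div.
Qed.

(** The constants are those of [ln_tilings] and [ln_traces] added up: [24 = 16 + 8] and
    [4 = 2 + 2]. *)
Lemma ln_le_linear (theta : R) : 0 < theta ->
  exists n0, forall n, (n0 <= n)%N -> 24 * ln n%:R + 4 <= theta * n%:R :> R.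
Proof.
(* With [r = sqrt n >= 1] and [ln n <= 2 r], the left side is at most [(24 * 2 + 4) r = 52 r]. *)
move=> theta0; pose c := 52 / theta; exists (Num.truncn (c ^+ 2)).+1 => n n0n.
have c0 : 0 <= c by rewrite divr_ge0// ltW.
have n0 : 1 <= n%:R :> R by rewrite ler1n (leq_trans _ n0n).
have cn : c ^+ 2 <= n%:R.
  by rewrite (le_trans (ltW (truncnS_gt _)))// ler_nat.
set r := Num.sqrt (n%:R : R); have rn : r ^+ 2 = n%:R by rewrite sqr_sqrtr// ler0n.
have r0 : 0 <= r by exact: sqrtr_ge0.
have r1 : 1 <= r by rewrite -sqrtr1 ler_wsqrtr.
have cr : c <= r by rewrite -(ger0_norm c0) -sqrtr_sqr ler_wsqrtr.
have lnr : ln n%:R <= 2 * r.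
  by rewrite -rn lnXn ?(lt_le_trans ltr01)// -[leLHS]mulr_natl ler_wpM2l// ltW// ln_sublinear// (lt_le_trans ltr01).
have : 52 <= theta * r by rewrite mulrC -ler_pdivrMr.
move=> theta_r; have : 52 * r <= theta * n%:R by rewrite -rn expr2 mulrA ler_wpM2r.
lra.
Qed.

End MarkerEntropy.

Section MarkerBounds.
Variables (R : realType) (G : groupType) (A : finType) (F : {fset G}).
Hypothesis countG : ([set: G] #= [set: nat])%card.
Let k := #|` F|.
Let N := (k * k).+1.
Hypotheses (k2 : (2 <= k)%N) (kA : (#|A| <= k)%N) (A0 : (0 < #|A|)%N).
Implicit Types (H : {fset G}) (e : R).

Lemma ln_tilings H e : #|` H|%:R <= 2 * e -> #|` fmul H F|%:R <= 2 * e ->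
  ln #|patterns H (tilings (N := N) F)|%:R <= e * (16 * ln k%:R + 2) / k%:R :> R.
Proof.
move=> He HFe; have k0 : 0 < k%:R :> R by rewrite ltr0n (leq_trans _ k2).
have lk0 : 0 <= ln k%:R :> R by rewrite ln_ge0// ler1n (leq_trans _ k2).
(* The parameter [s = N k] reduces the contribution of the [N] colours per site to [1 / k], and
   [N k <= k^4] keeps [ln s] within [4 ln k]. *)
have s1 : 1 <= (N * k)%:R :> R by rewrite ler1n muln_gt0/= (leq_trans _ k2).
have lns : ln (N * k)%:R <= 4 * ln k%:R :> R.
  rewrite mulr_natl -lnXn// ler_ln ?posrE ?exprn_gt0//; last exact: lt_le_trans s1.
  rewrite -natrX ler_nat /N; move: k2; clear; nia.
have [chi tchi] := tiling_exists F countG.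
apply: (le_trans (@ln_patterns_markers R G _ _ H k #|` fmul H F| (N * k)%:R _ _ s1 _)).
- by exists chi.
- exact: leq_trans k2.
- by move=> x tx; exact: card_support.
have -> : e * (16 * ln k%:R + 2) / k%:R = 2 * (2 * e) / k%:R * (4 * ln k%:R) + (2 * e) * k%:R^-1.
  by field; rewrite gt_eqF.
have e0 : 0 <= e by rewrite -(@pmulr_rge0 _ 2)// (le_trans _ He).
apply: lerD.
  apply: ler_pM => //; rewrite ?divr_ge0 ?mulr_ge0 ?ln_ge0//.
  by rewrite ler_pM2r ?invr_gt0// ler_pM2l.
have -> : #|'I_N|%:R / (N * k)%:R = k%:R^-1 :> R.
  by rewrite card_ord natrM; field; rewrite gt_eqF//= -[N]/(k * k).+1 pnatr_eq0.
by rewrite ler_pM2r ?invr_gt0.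
Qed.

Lemma ln_traces H e f : f \in F -> #|` H|%:R <= 2 * e ->
    #|` fmul (fmul H (finv F)) F|%:R <= 2 * e ->
  ln #|patterns H (traces (A := A) N F f)|%:R <= e * (8 * ln k%:R + 2) / k%:R :> R.
Proof.
move=> fF He HFe; have k0 : 0 < k%:R :> R by rewrite ltr0n (leq_trans _ k2).
have lk0 : 0 <= ln k%:R :> R by rewrite ln_ge0// ler1n (leq_trans _ k2).
have a0 : 0 < #|A|%:R :> R by rewrite ltr0n.
have s1 : 1 <= (#|A| * k)%:R :> R by rewrite ler1n muln_gt0/= A0 (leq_trans _ k2).
have lns : ln (#|A| * k)%:R <= 2 * ln k%:R :> R.
  rewrite mulr_natl -lnXn// ler_ln ?posrE ?exprn_gt0//; last exact: lt_le_trans s1.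
  by rewrite -natrX ler_nat expnS expn1 leq_mul2r kA orbT.
have [chi tchi] := tiling_exists F countG.
have /card_gt0P[a _] := A0.
apply: (le_trans (@ln_patterns_markers R G _ _ H k #|` fmul (fmul H (finv F)) F| (#|A| * k)%:R _ _ s1 _)).
- by exists (trace f chi (fun=> a)), chi, (fun=> a).
- exact: leq_trans k2.
- move=> _ [chi' [w [tchi' ->]]]; apply: leq_trans (card_support tchi' _).
  rewrite leq_mul2r; apply/orP; right.
  apply: (leq_card_inj (f := fun h => h * f^-1)%g) => [? ? _ _ /mulIg//|h].
  rewrite !inE => /andP[hH]; rewrite /trace; case: ifP => // _ _.
  by rewrite andbT; apply: mem_fmul => //; rewrite mem_finv invgK.
have -> : e * (8 * ln k%:R + 2) / k%:R = 2 * (2 * e) / k%:R * (2 * ln k%:R) + (2 * e) * k%:R^-1.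
  by field; rewrite gt_eqF.
have e0 : 0 <= e by rewrite -(@pmulr_rge0 _ 2)// (le_trans _ He).
apply: lerD.
  apply: ler_pM => //; rewrite ?divr_ge0 ?mulr_ge0 ?ln_ge0//.
  by rewrite ler_pM2r ?invr_gt0// ler_pM2l.
have -> : #|A|%:R / (#|A| * k)%:R = k%:R^-1 :> R.
  by rewrite natrM; field; rewrite !gt_eqF.
by rewrite ler_pM2r ?invr_gt0.
Qed.

End MarkerBounds.

Section StepEstimates.
Variables (R : realType) (G : groupType) (A : finType) (F B C M F0 L : {fset G}).
Variables (P : set (configuration G A)) (w0 : configuration G A) (E : {fset G}).
Hypothesis countG : ([set: G] #= [set: nat])%card.
Let k := #|` F|.
Let N := (k * k).+1.
Hypotheses (k2 : (2 <= k)%N) (kA : (#|A| <= k)%N).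
Hypotheses (B1 : 1%g \in B) (C1 : 1%g \in C) (L1 : 1%g \in L).
Hypothesis L2 : {subset fmul (finv F) F <= L}.
Hypothesis L3 : {subset fmul (fmul (finv F) F) (finv F) <= L}.
Hypothesis FL : {subset F <= L}.
Hypothesis MB : forall m m', m \in M -> m' \in M -> (m^-1 * m')%g \in B.
Hypothesis W0 : window_hull M P !=set0.
Variables (kappa theta : R).
Hypotheses (kappa0 : 0 <= kappa) (kappa1 : kappa <= 1) (E0 : E != fset0).
(** A single large product, so that [E L], [E L L], [E L C] and the further products met below are
    all almost as small as [E]. *)
Hypothesis E_inv : forall X : {fset G},
  {subset X <= fmul E (fmul (fmul L (C `|` L)) L)%fset} ->
  #|` X|%:R <= (1 + kappa) * #|` E|%:R :> R.
Hypothesis k_large : 24 * ln k%:R + 4 <= theta * k%:R.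

Local Notation W := (window_hull M P).
Local Notation refillsJ J := (refills N F B M P w0 J).
Local Notation a := (ln #|A|%:R : R).
Local Notation e := (#|` E|%:R : R).

Let e0 : 0 < e. Proof. by rewrite ltr0n cardfs_gt0. Qed.
Let k0 : 0 < k%:R :> R. Proof. by rewrite ltr0n (leq_trans _ k2). Qed.
Let A0 : (0 < #|A|)%N. Proof. exact: alphabet_gt0 W0. Qed.
Let a0 : 0 <= a. Proof. by rewrite ln_ge0// ler1n. Qed.

Let tiling0 : tilings (N := N) F !=set0.
Proof. by have [chi] := tiling_exists F countG; exists chi. Qed.

Lemma refills_nonempty J : refillsJ J !=set0.
Proof.
have [w Ww] := W0; have [chi tchi] := tiling0.
have [|x rx _] := @refills_agree _ _ _ _ _ _ _ w0 B1 J chi fset0 w tchi _ Ww.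
  by move=> h d; rewrite in_fset0.
by exists x.
Qed.

Let E_inv2 (X : {fset G}) : {subset X <= fmul E (fmul (fmul L (C `|` L)) L)%fset} ->
  #|` X|%:R <= 2 * e.
Proof.
move=> /E_inv/le_trans; apply; rewrite ler_wpM2r//.
by rewrite -[leRHS]/(1 + 1) lerD2l.
Qed.

Let mem_big x y l c z : x \in E -> y \in L -> c \in C \/ c \in L -> z \in L ->
  l = (y * c * z)%g -> (x * l)%g \in fmul E (fmul (fmul L (C `|` L)) L)%fset.
Proof.
by move=> xE yL cCL zL ->; rewrite !mem_fmul// inE; apply/orP.
Qed.

Let EL_big : {subset fmul E L <= fmul E (fmul (fmul L (C `|` L)) L)%fset}.
Proof.
move=> _ /fmulP[x [y [xE yL ->]]].
by apply: (mem_big (y := y) (c := 1%g) (z := 1%g)) => //; [left|rewrite !mulg1].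
Qed.

Let ELL_big : {subset fmul (fmul E L) L <= fmul E (fmul (fmul L (C `|` L)) L)%fset}.
Proof.
move=> _ /fmulP[_ [z [/fmulP[x [y [xE yL ->]]] zL ->]]]; rewrite -mulgA.
by apply: (mem_big (y := y) (c := 1%g) (z := z)) => //; [left|rewrite mulg1].
Qed.

Let card_EL : (#|` E| <= #|` fmul E L|)%N.
Proof. by apply/fsubset_leq_card/fsubsetP; exact: fmul1. Qed.

Let ln_tilings_ELL :
  ln #|patterns (fmul (fmul E L) L) (tilings (N := N) F)|%:R <= e * (16 * ln k%:R + 2) / k%:R.
Proof.
apply: ln_tilings => //; apply: E_inv2; first exact: ELL_big.
move=> _ /fmulP[_ [f [/fmulP[_ [z [/fmulP[x [y [xE yL ->]]] zL ->]]] fF ->]]].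
rewrite -!mulgA (mulgA y); apply: (mem_big (y := y) (c := z) (z := f)) => //; first by right.
exact: FL.
Qed.

(** The logarithm of [leq_refills_cons]: the markers and the trace cost at most [theta] per cell,
    and returning from the window [E L] to [E] costs [kappa ln |A|]. *)
Lemma rate_refills_cons f J : f \in F ->
  rate R E (refillsJ J) <= rate R E (refillsJ (f :: J)) + (theta + kappa * a).
Proof.
move=> fF; have := leq_refills_cons N M P w0 B1 L1 L2 L3 J f E.
set nt := #|patterns (fmul (fmul E L) L) _|; set ntr := #|patterns _ (traces _ _ _)|.
set nH := #|patterns (fmul E L) (refills _ _ _ _ _ _ _)| => le_n.
have nH_le : (nH <= #|patterns E (refillsJ (f :: J))| * #|A| ^ (#|` fmul E L| - #|` E|))%N.
  by apply: leq_patterns_cat; exact: fmul1.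
have nt_le : ln nt%:R <= e * (16 * ln k%:R + 2) / k%:R by exact: ln_tilings_ELL.
have ntr_le : ln ntr%:R <= e * (8 * ln k%:R + 2) / k%:R.
  apply: ln_traces => //; apply: E_inv2 => //.
  move=> _ /fmulP[_ [u [/fmulP[_ [v [/fmulP[x [y [xE yL ->]]] vF ->]]] uF ->]]].
  rewrite -!mulgA; apply: (mem_big (y := y) (c := 1%g) (z := (v * u)%g)) => //; first by left.
    by apply: L2; exact: mem_fmul.
  by rewrite mulg1.
set n1 := #|patterns E (refillsJ J)| in le_n *.
set n2 := #|patterns E (refillsJ (f :: J))| in nH_le *.
have n1_gt0 : (0 < n1)%N by rewrite -(ltr_nat R) patterns_gt0//; exact: refills_nonempty.
have n2_gt0 : 0 < n2%:R :> R by apply: patterns_gt0; exact: refills_nonempty.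
have le_n' : (n1 <= nt * (ntr * (n2 * #|A| ^ (#|` fmul E L| - #|` E|))))%N.
  by apply: leq_trans le_n _; rewrite !leq_mul2l nH_le !orbT.
have := leq_trans n1_gt0 le_n'; rewrite !muln_gt0 => /andP[nt0 /andP[ntr0 /andP[_ Ap]]].
have : ln n1%:R <= ln nt%:R + (ln ntr%:R + (ln n2%:R + (#|` fmul E L|%:R - e) * a)).
  have -> : (#|` fmul E L|%:R - e) * a = ln (#|A| ^ (#|` fmul E L| - #|` E|))%N%:R.
    by rewrite natrX lnXn ?ltr0n// -[RHS]mulr_natl natrB// card_EL.
  have n2N : (0 < n2)%N by rewrite -(ltr_nat R).
  rewrite -!lnM ?posrE ?mulr_gt0 ?ltr0n// -!natrM.
  by rewrite ler_ln ?posrE ?ltr0n ?muln_gt0 ?nt0 ?ntr0 ?n2N ?Ap// ler_nat.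
have HE : #|` fmul E L|%:R - e <= kappa * e.
  by have := E_inv EL_big; rewrite mulrDl mul1r lerBlDl.
rewrite /rate -/n1 -/n2 => le_ln; rewrite ler_pdivrMr// mulrDl divfK ?gt_eqF//.
have te : e * (16 * ln k%:R + 2) / k%:R + e * (8 * ln k%:R + 2) / k%:R <= theta * e.
  rewrite -mulrDl ler_pdivrMr// -mulrDr mulrC mulrAC ler_wpM2r ?(ltW e0)//.
  by apply: le_trans k_large; lra.
have ha : (#|` fmul E L|%:R - e) * a <= kappa * e * a by rewrite ler_wpM2r.
lra.
Qed.

Hypotheses (F0n0 : F0 != fset0) (CV : forall c, c \in C -> c^-1%g \in C)
  (BC : {subset B <= C})
  (FBC : forall u v b, u \in F0 -> v \in F0 -> b \in B -> (v^-1 * u * b)%g \in C).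
Variables (kappaF beta : R).
Hypothesis F_inv : #|` fmul F C|%:R <= (1 + kappaF) * #|` F|%:R :> R.
Hypothesis kappaF_beta : 4 * kappaF * #|` C|%:R ^+ 2 <= beta.

Let card_boundary chi : tiling (N := N) F chi ->
  #|` tile_boundary F chi C (fmul E L)|%:R <= beta * e.
Proof.
move=> tchi; have := card_tile_boundary tchi C1 CV (fmul E L).
rewrite -(ler_nat R) !natrM natrB; last first.
  by apply/fsubset_leq_card/fsubsetP; exact: fmul1.
set X := fmul _ F => le_tb.
have XE : #|` X|%:R <= 2 * e.
  apply: E_inv2.
  move=> _ /fmulP[_ [u [/fmulP[_ [v [/fmulP[_ [c [/fmulP[x [y [xE yL ->]]] cC ->]]] vF ->]]] uF ->]]].
  rewrite -!mulgA; apply: (mem_big (y := y) (c := c) (z := (v * u)%g)) => //; first by left.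
    by apply: L2; exact: mem_fmul.
  by rewrite mulgA.
have FCF : #|` fmul F C|%:R - k%:R <= kappaF * k%:R.
  by have := F_inv; rewrite mulrDl mul1r lerBlDl.
have FCF0 : 0 <= #|` fmul F C|%:R - k%:R :> R.
  by rewrite subr_ge0 ler_nat; apply/fsubset_leq_card/fsubsetP; exact: fmul1.
rewrite -(ler_pM2r k0); apply: (le_trans le_tb).
apply: (@le_trans _ _ (2 * (2 * e) * (kappaF * k%:R * #|` C|%:R * #|` C|%:R))).
  apply: ler_pM; rewrite ?mulr_ge0//; first by rewrite ler_wpM2l.
  by rewrite ler_wpM2r// ler_wpM2r.
rewrite (_ : _ * _ = 4 * kappaF * #|` C|%:R ^+ 2 * (e * k%:R)); last by ring.
by rewrite -[leRHS]mulrA ler_wpM2r// mulr_ge0// ltW.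
Qed.

(** At most [(1/2 + kappa + beta) |E|] cells of [E L] are uncovered, and [ln_patterns_uncovered]
    charges [rate R F0 W] for each, up to boundary terms; the markers cost [theta]. *)
Lemma rate_refills_full (J : seq G) : {subset F <= J} -> rate R E (refillsJ J) <=
  rate R F0 W / 2 + (theta + (kappa + beta) * (a * (1 + #|` F0|%:R))).
Proof.
move=> FJ; have [chi tchi le_n] := leq_refills_full M P w0 B1 L1 L2 L3 E FJ tiling0.
set H := fmul E L in le_n *; set Q := uncovered F B chi H in le_n *.
have Fn0 : F != fset0 by rewrite -cardfs_gt0 (leq_trans _ k2).
have EFH : {subset fmul E F <= H} by apply: fmulS.
have := card_uncovered tchi Fn0 BC EFH.
rewrite -/Q -(ler_nat R) natrD [in leRHS]natrD !natrM => cardQ.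
have := ln_patterns_uncovered R F chi F0n0 B1 C1 FBC H (@invariant_window_hull _ _ M P) W0.
rewrite -/Q natrM natrD natrB; last by apply/fsubset_leq_card/fsubsetP; exact: fmul1.
have := card_boundary tchi; set tb := #|` tile_boundary _ _ _ _|%:R => tb_le lnQ.
set nt := #|patterns (fmul H L) _| in le_n.
set nQ := #|patterns Q _| in le_n lnQ.
set n1 := #|patterns E (refillsJ J)| in le_n.
have n1_gt0 : (0 < n1)%N by rewrite -(ltr_nat R) patterns_gt0//; exact: refills_nonempty.
have := leq_trans n1_gt0 le_n; rewrite !muln_gt0 => /andP[nt0 nQ0].
have ln_n1 : ln n1%:R <= ln nt%:R + ln nQ%:R :> R.
  by rewrite -lnM ?posrE ?ltr0n// ler_ln ?posrE ?ltr0n ?mulr_gt0 ?ltr0n// -natrM ler_nat.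
have nt_le : ln nt%:R <= e * (16 * ln k%:R + 2) / k%:R by exact: ln_tilings_ELL.
have lk0 : 0 <= ln k%:R :> R by rewrite ln_ge0// ler1n (leq_trans _ k2).
have te : e * (16 * ln k%:R + 2) / k%:R <= theta * e.
  rewrite ler_pdivrMr// mulrC mulrAC ler_wpM2r ?(ltW e0)//.
  by apply: le_trans k_large; lra.
set q := rate R F0 W in lnQ *.
have q0 : 0 <= q by apply: rate_ge0.
have F0_gt0 : 0 < #|` F0|%:R :> R by rewrite ltr0n cardfs_gt0.
have qa : q <= a by rewrite ler_pdivrMr// mulrC; exact: ln_patterns_max.
have HE : #|` H|%:R <= (1 + kappa) * e by exact: E_inv.
have EH : e <= #|` H|%:R by rewrite ler_nat card_EL.
have HCE : #|` fmul H C|%:R <= (1 + kappa) * e.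
  apply: E_inv => _ /fmulP[_ [c [/fmulP[x [y [xE yL ->]]] cC ->]]]; rewrite -mulgA.
  by apply: (mem_big (y := y) (c := c) (z := 1%g)) => //; [left|rewrite mulg1].
have tb0 : 0 <= tb by exact: ler0n.
have be0 : 0 <= beta * e by exact: le_trans tb_le.
have Qle : #|` Q|%:R <= e / 2 + (kappa + beta) * e by move: cardQ; rewrite -/tb; lra.
have Qq : #|` Q|%:R * q <= e / 2 * q + (kappa + beta) * e * a.
  apply: (le_trans (ler_wpM2r q0 Qle)); rewrite mulrDl lerD2l ler_wpM2l//.
  by rewrite mulrDl addr_ge0// ?mulr_ge0 ?(ltW e0).
have bad : (#|` fmul H C|%:R - #|` H|%:R + tb) * #|` F0|%:R * a <=
    (kappa + beta) * e * #|` F0|%:R * a.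
  rewrite ler_wpM2r// ler_wpM2r// ; lra.
rewrite [leLHS]/rate -/n1 ler_pdivrMr//.
have -> : (q / 2 + (theta + (kappa + beta) * (a * (1 + #|` F0|%:R)))) * e =
   e / 2 * q + (kappa + beta) * e * a + (kappa + beta) * e * #|` F0|%:R * a + theta * e.
  by ring.
lra.
Qed.

End StepEstimates.

(** * One round of refilling, and entropies just above the threshold *)

Section Step.
Variables (R : realType) (G : groupType) (S : {fset G}) (A : finType).
Hypotheses (countG : ([set: G] #= [set: nat])%card) (genS : generates S)
  (amenG : amenable R S).

Lemma large_fset n : exists T : {fset G}, (n <= #|` T|)%N.
Proof.
have [code [e [_ eK]]] := numbering countG.
exists [fset x in [seq e i | i <- iota 0 n]]%fset.
rewrite card_fseq undup_id ?size_map ?size_iota// map_inj_uniq ?iota_uniq//.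
exact: can_inj eK.
Qed.

(** Invariance under a set [T] of [2 n] or more elements forces size: [F T] contains a translate of
    [T] and has at most [2 |F|] elements. *)
Lemma large_invariant_fset (C : {fset G}) (kappa : R) (n : nat) : 0 < kappa ->
  exists F : {fset G}, [/\ F != fset0, (n <= #|` F|)%N &
    #|` fmul F C|%:R <= (1 + kappa) * #|` F|%:R :> R].
Proof.
move=> kappa0; have [T nT] := large_fset (2 * n).
have [F folF] := amenG; have [Fn0 _] := folF.
have k0 : 0 < Num.min kappa 1 by rewrite lt_min kappa0 ltr01.
have [N _ /(_ N (leqnn N)) /= FN] := folner_fmul (C `|` T)%fset genS folF k0.
exists (F N); split=> //.
  have /fset0Pn[f fF] := Fn0 N.
  rewrite -(leq_pmul2l (isT : 0 < 2)%N) (leq_trans nT)// -(ler_nat R).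
  apply: (@le_trans _ _ (#|` fmul (F N) (C `|` T)%fset|%:R : R)).
    rewrite ler_nat; apply: (leq_card_inj (f := fun t => f * t)%g) => [? ? _ _ /mulgI//|t tT].
    by rewrite mem_fmul// inE tT orbT.
  rewrite (le_trans FN)// natrM ler_wpM2r// -[leRHS]/(1 + 1) lerD2l.
  by rewrite ge_min lexx orbT.
apply: (@le_trans _ _ (#|` fmul (F N) (C `|` T)%fset|%:R : R)).
  by rewrite ler_nat; apply/fsubset_leq_card/fsubsetP/fmulS => // c cC; rewrite inE cC.
by rewrite (le_trans FN)// ler_wpM2r// lerD2l ge_min lexx.
Qed.

(** A cell is finite and the group is infinite, so some [h] in a cell has a neighbour [h s] outside.
    After moving [h] to 1, a cell with an interior point in [K] would contain both 1 and [s]. *)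
Lemma tiling_avoiding N (F B K : {fset G}) : F != fset0 ->
    (exists chi : configuration G (option 'I_N), tiling F chi) ->
    (forall k, k \in K -> k^-1%g \in B) ->
    (forall k s, k \in K -> s \in S -> (k^-1 * s)%g \in B /\ (k^-1 * s^-1)%g \in B) ->
  exists2 chi : configuration G (option 'I_N), tiling F chi &
    forall k d, k \in K -> ~ interior_cell F B chi d k.
Proof.
move=> F0 [chi tchi] KB KSB.
have [d0 [u0 du0]] : exists d u, cell F chi d u.
  have := tiling_dense tchi 1%g; set X := imfset _ _ _ => FX.
  have /fset0Pn[u] : X != fset0.
    by apply: contraTneq FX => ->; rewrite cardfs0 muln0 leqn0 cardfs_eq0.
  by rewrite !inE => /andP[_ /asboolP[d du]]; exists d, (1 * u)%g.
have [h [s [sS dh ndhs]]] : exists h s,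
    [/\ (s \in S) || (s^-1%g \in S), cell F chi d0 h & ~ cell F chi d0 (h * s)%g].
  apply: contrapT => nex.
  have closed_cell h s : (s \in S) || (s^-1%g \in S) -> cell F chi d0 h ->
      cell F chi d0 (h * s)%g.
    by move=> sS dh; apply: contrapT => ndhs; apply: nex; exists h, s.
  have all_cell g : cell F chi d0 (u0 * g)%g.
    have [w wS <-] := genS g; elim: w u0 du0 wS => [|s w IHw] h dh /=.
      by rewrite big_nil mulg1.
    by move=> /andP[sS wS]; rewrite big_cons mulgA; apply: IHw => //; exact: closed_cell.
  have [T] := large_fset #|` F|.+1; rewrite ltnNge => /negP; apply.
  apply: (leq_card_inj (f := fun g => d0^-1 * (u0 * g))%g) => [? ? _ _ /mulgI/mulgI//|g _].
  by have [] := all_cell g.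
exists (translate h^-1%g chi); first exact: tiling_translate.
move=> k d kK /interior_cell_translate; rewrite invgK => int.
have hd : (h * d)%g = d0.
  have := int _ (KB k kK); rewrite mulgK => /(cell_uniq tchi); exact.
apply: ndhs; have : (k^-1 * s)%g \in B.
  have [sS'|] := boolP (s \in S); first by have [] := KSB _ _ kK sS'.
  by move: sS => /orP[->//|sS'] _; have [_] := KSB _ _ kK sS'; rewrite invgK.
by move=> /int; rewrite hd mulgA mulgK.
Qed.

Lemma hent_mono (P Q : set (configuration G A)) : P !=set0 -> P `<=` Q ->
  hent R P <= hent R Q.
Proof.
move=> P0 PQ; have Q0 : Q !=set0 by have [x /PQ] := P0; exists x.
apply: hent_ge => // F F0; apply: le_trans (hent_le R P0 F0) _.
rewrite /rate ler_wpM2r// ler_ln ?posrE ?patterns_gt0// ler_nat.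
by apply: leq_patterns => // x /PQ; exists x.
Qed.

Lemma hent_closed_shift (P : set (configuration G A)) (invP : invariant P) :
  hent R (closed_shift invP) = hent R P.
Proof.
congr inf; apply/seteqP; split=> _ [F F0 <-]; exists F => //.
  by rewrite /rate patterns_cl.
by rewrite /rate patterns_cl.
Qed.

(** The parameters are fixed in this order: the windows [B] and [C], the tolerances, a large tile
    [F] almost invariant under [C], the locality window [L], and for each [J] a Folner set [E]
    adapted to [L] and [C]. *)
Lemma refill_step (X : subshift G A) (K F0 : {fset G}) (eta : R) :
    shift_set X !=set0 -> F0 != fset0 -> 0 < eta ->
  exists (s : seq G) (Z : seq G -> subshift G A),
    [/\ forall J, patterns K (Z J) = patterns K X, hent R X <= hent R (Z [::]),
      forall f J, f \in s -> hent R (Z J) <= hent R (Z (f :: J)) + eta &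
      hent R (Z s) <= rate R F0 X / 2 + eta].
Proof.
move=> X0 F0n0 eta0; have [w0 Xw0] := X0.
have A0 : (0 < #|A|)%N := alphabet_gt0 X0.
pose a : R := ln #|A|%:R; have a0 : 0 <= a by rewrite ln_ge0// ler1n.
pose M := (K `|` F0)%fset.
(* [S] is included for [tiling_avoiding], which needs [k^-1 s] in [B]. *)
pose U := (M `|` S `|` [fset 1%g])%fset.
pose Y := (U `|` finv U)%fset.
pose B := fmul Y Y; pose C := fmul B B.
have Y1 : 1%g \in Y by rewrite !inE eqxx !orbT.
have YV y : y \in Y -> y^-1%g \in Y.
  by rewrite [y \in _]in_fsetU [_^-1%g \in Y]in_fsetU !mem_finv invgK orbC.
have MY m : m \in M -> m \in Y by move=> mM; rewrite /Y /U 3!in_fsetU mM.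
have SY s : s \in S -> s \in Y by move=> sS; rewrite /Y /U 3!in_fsetU sS !orbT.
have KY k : k \in K -> k \in Y by move=> kK; apply: MY; rewrite in_fsetU kK.
have FY f : f \in F0 -> f \in Y by move=> fF; apply: MY; rewrite in_fsetU fF orbT.
have B1 : 1%g \in B by rewrite -[1%g]mulg1 mem_fmul.
have BV b : b \in B -> b^-1%g \in B.
  by move=> /fmulP[x [y [xY yY ->]]]; rewrite invgM mem_fmul// YV.
have C1 : 1%g \in C by rewrite -[1%g]mulg1 mem_fmul.
have CV c : c \in C -> c^-1%g \in C.
  by move=> /fmulP[x [y [xY yY ->]]]; rewrite invgM mem_fmul// BV.
have BC : {subset B <= C} by exact: fmul1.
have MB m m' : m \in M -> m' \in M -> (m^-1 * m')%g \in B.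
  by move=> mM m'M; rewrite mem_fmul ?YV ?MY.
have FBC u v b : u \in F0 -> v \in F0 -> b \in B -> (v^-1 * u * b)%g \in C.
  by move=> uF vF bB; rewrite !mem_fmul ?YV ?FY.
(* This makes each of the error terms for [kappa] and [beta = kappa] at most [eta / 4]; the last 1
   keeps [D] positive when [a = 0]. *)
pose D := 4 * (a * (1 + #|` F0|%:R) + 1).
have D0 : 0 < D by rewrite mulr_gt0// ltr_wpDl// mulr_ge0// addr_ge0.
pose kappa := Num.min (eta / D) 1.
have kappa0 : 0 < kappa by rewrite lt_min ltr01 divr_gt0.
have kappa1 : kappa <= 1 by rewrite ge_min lexx orbT.
have kappa_eta : kappa * (a * (1 + #|` F0|%:R)) <= eta / 4.
  apply: (@le_trans _ _ (eta / D * (D / 4))).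
    apply: ler_pM; rewrite ?(ltW kappa0) ?mulr_ge0 ?addr_ge0//.
      by rewrite ge_min lexx.
    by rewrite ler_pdivlMr// mulrC ler_pM2l// lerDl.
  by rewrite mulrA divfK ?gt_eqF.
have kappa_a : kappa * a <= eta / 4.
  apply: le_trans kappa_eta; rewrite ler_wpM2l ?(ltW kappa0)//.
  by rewrite ler_peMr// lerDl.
have cC : 0 < 4 * #|` C|%:R ^+ 2 :> R.
  by rewrite mulr_gt0// exprn_gt0// ltr0n cardfs_gt0; apply/fset0Pn; exists 1%g.
pose kappaF := kappa / (4 * #|` C|%:R ^+ 2).
have kappaF0 : 0 < kappaF by exact: divr_gt0.
have kappaF_kappa : 4 * kappaF * #|` C|%:R ^+ 2 <= kappa.
  by rewrite mulrAC /kappaF mulrC divfK ?gt_eqF.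
have [n1 n1P] := @ln_le_linear R (eta / 4) (divr_gt0 eta0 (ltr0Sn _ _)).
have [F [Fn0 nF FC]] := large_invariant_fset C (maxn (maxn 2 #|A|) n1) kappaF0.
have [/andP[k2 kA] kn1] : (2 <= #|` F|)%N && (#|A| <= #|` F|)%N /\ (n1 <= #|` F|)%N.
  by move: nF; rewrite !geq_max => /andP[-> ->].
have k_large := n1P _ kn1.
pose N := (#|` F| * #|` F|).+1.
pose V := (F `|` finv F `|` [fset 1%g])%fset.
pose L := fmul (fmul V V) V.
have V1 : 1%g \in V by rewrite !inE eqxx orbT.
have FV : {subset F <= V} by move=> f fF; rewrite /V 2!in_fsetU fF.
have FiV : {subset finv F <= V} by move=> f fF; rewrite /V 2!in_fsetU fF orbT.
have VV1 : {subset V <= fmul V V} by exact: fmul1.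
have VVL : {subset fmul V V <= L} by exact: fmul1.
have L1 : 1%g \in L by apply/VVL/VV1.
have L2 : {subset fmul (finv F) F <= L} by move=> x xF; apply: VVL; exact: fmulS xF.
have L3 : {subset fmul (fmul (finv F) F) (finv F) <= L}.
  by apply: fmulS => //; exact: fmulS.
have FL : {subset F <= L} by move=> x /FV/VV1/VVL.
pose W := window_hull M X.
have invX : invariant X by exact: shift_invariant.
have XW : X `<=` W by exact: sub_window_hull.
have W0 : W !=set0 by exists w0; exact: XW.
have tiling0 : tilings (N := N) F !=set0 by have [chi] := tiling_exists F countG; exists chi.
pose P J := refills N F B M X w0 J.
have P0 J : P J !=set0 by exact: refills_nonempty.
have invP J : invariant (P J) by exact: invariant_refills.
exists (enum_fset F), (fun J => closed_shift (invP J)).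
have [Fn folFn] := amenG; have [Fnn0 _] := folFn.
have nearE J : exists E : {fset G}, [/\ E != fset0,
    rate R E (P J) <= hent R (P J) + eta / 4 &
    forall T : {fset G}, {subset T <= fmul E (fmul (fmul L (C `|` L)) L)%fset} ->
      #|` T|%:R <= (1 + kappa) * #|` E|%:R :> R].
  have e40 : 0 < eta / 4 by exact: divr_gt0.
  have near1 := rate_near_hent (P0 J) (invP J) genS folFn e40.
  have near2 := folner_fmul (fmul (fmul L (C `|` L)) L)%fset genS folFn kappa0.
  have [n _ /(_ n (leqnn n)) /= [rn cn]] : \forall n \near \oo,
      rate R (Fn n) (P J) <= hent R (P J) + eta / 4 /\
      #|` fmul (Fn n) (fmul (fmul L (C `|` L)) L)%fset|%:R <= (1 + kappa) * #|` Fn n|%:R.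
    by near=> n; split; near: n.
  exists (Fn n); split=> // T /fsubsetP/fsubset_leq_card TE.
  by apply: le_trans cn; rewrite ler_nat.
split=> [J||f J fF|].
- rewrite patterns_cl; apply/patterns_eqP; split=> x.
    move=> /(refills_hull B1 MB)/window_hull_agree[y Xy xy]; exists y => // k kK.
    by apply: xy; rewrite in_fsetU kK.
  (* Conversely, a tiling whose interiors all avoid [K] leaves the pattern of [x] on [K]
     untouched. *)
  move=> /XW Wx.
  have [||chi tchi avoid] := @tiling_avoiding N F B K Fn0 tiling0.
  - move=> k kK; rewrite -[k^-1%g]mulg1; apply: mem_fmul => //.
    exact/YV/KY.
  - move=> k s kK sS; have kY : k^-1%g \in Y by exact/YV/KY.
    by split; apply: mem_fmul => //; [exact: SY|exact/YV/SY].
  exact: (refills_agree w0 B1 J tchi avoid Wx).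
- rewrite hent_closed_shift; apply: hent_mono => // x /XW.
  exact: hull_refills_nil.
- rewrite !hent_closed_shift.
  have [E [E0 rE Einv]] := nearE (f :: J).
  apply: le_trans (hent_le R (P0 J) E0) _.
  have := @rate_refills_cons R G A F B C M L X w0 E countG k2 kA B1 C1 L1 L2 L3 FL W0
    kappa (eta / 4) kappa1 E0 Einv k_large f J fF.
  rewrite -/a -/(P J) -/(P (f :: J)) => le_rate; apply: (le_trans le_rate).
  by move: rE kappa_a eta0; clear; lra.
- rewrite hent_closed_shift.
  have [E [E0 _ Einv]] := nearE (enum_fset F).
  apply: le_trans (hent_le R (P0 _) E0) _.
  have := @rate_refills_full R G A F B C M F0 L X w0 E countG k2 B1 C1 L1 L2 L3 FL
    W0 kappa (eta / 4) (ltW kappa0) kappa1 E0 Einv k_large F0n0 CV BC FBC kappaF kappa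
    FC kappaF_kappa (enum_fset F) (fun x xF => xF).
  have -> : rate R F0 (window_hull M X) = rate R F0 X.
    rewrite /rate; congr (ln _%:R / _); congr #|pred_of_set _|; apply/patterns_eqP.
    split=> x; last by move=> /XW; exists x.
    move=> /window_hull_agree[y Xy xy]; exists y => // k kF.
    by apply: xy; rewrite in_fsetU kF orbT.
  move=> /le_trans; apply; rewrite lerD2l mulrDl -/a.
  by move: kappa_eta eta0; clear; lra.
Unshelve. all: by end_near. Qed.

Variable c : R.
Hypothesis c0 : 0 <= c.

(** If no entropy falls into the gap between [c] and [c + eps], a chain of refillings, losing at
    most [eps / 8] per step, never crosses it. The halving is then used backwards: a lower bound
    valid for all such shifts holds for [Z s] and improves for [Y], until it exceeds the entropy of
    [X]. *)
Lemma approx_entropy (X : subshift G A) (K : {fset G}) (eps : R) :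
    shift_set X !=set0 -> c <= hent R X -> 0 < eps ->
  exists Y : subshift G A,
    [/\ patterns K Y = patterns K X, c <= hent R Y & hent R Y < c + eps].
Proof.
move=> X0 cX eps0; apply: contrapT => nex.
have gap (Y : subshift G A) : patterns K Y = patterns K X -> c <= hent R Y ->
    c + eps <= hent R Y.
  by move=> YX cY; rewrite leNgt; apply/negP => Yc; apply: nex; exists Y.
have unbounded n : forall Y : subshift G A, patterns K Y = patterns K X ->
    c <= hent R Y -> n%:R * (eps / 4) <= hent R Y.
  elim: n => [|n IHn] Y YX cY; first by rewrite mul0r (le_trans c0).
  have Y0 : shift_set Y !=set0 by exact: patterns_nonempty (esym YX) X0.
  have e8 : 0 < eps / 8 by exact: divr_gt0.
  have [|F F0 FY] := @hent_lt R _ _ _ Y0 (hent R Y + eps / 8); first by rewrite ltrDl.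
  have [s [Z [ZK YZ Zstep Zs]]] := @refill_step Y K F (eps / 8) Y0 F0 e8.
  have cZ J : {subset J <= s} -> c <= hent R (Z J).
    elim: J => [|f J IHJ] Js; first exact: le_trans YZ.
    have fs : f \in s by apply: Js; rewrite inE eqxx.
    have {}IHJ : c <= hent R (Z J) by apply: IHJ => g gJ; apply: Js; rewrite inE gJ orbT.
    have := gap (Z J) (etrans (ZK J) YX) IHJ; have := Zstep f J fs; lra.
  have cZs : c <= hent R (Z s) by exact: cZ.
  (* With [x] the bound for [n], halving gives [hent R Y > 2 x - 3 eps / 8], and the gap gives
     [hent R Y >= eps]; their mean is at least [x + eps / 4]. *)
  have := IHn (Z s) (etrans (ZK s) YX) cZs; have := gap Y YX cY.
  rewrite -(natr1 n) mulrDl mul1r; move: (n%:R * _) Zs FY c0 eps0 => x.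
  move: (hent R Y) (hent R (Z s)) (rate R F Y) => y z r; lra.
have [n Xn] : exists n : nat, hent R X < n%:R * (eps / 4).
  exists (Num.truncn (hent R X / (eps / 4))).+1.
  by rewrite -ltr_pdivrMr ?divr_gt0// truncnS_gt.
by have := unbounded n X erefl cX; rewrite leNgt Xn.
Qed.

End Step.

(** * Density and conclusion *)

Section Generic.
Variables (R : realType) (G : groupType) (S : {fset G}) (A : finType).

(** The rate at [F] depends only on the [F]-patterns, which are locally constant in the shift. *)
Lemma open_rate_lt (t : R) :
  open [set X : subshift G A | exists2 F, F != fset0 & rate R F X < t].
Proof.
rewrite openE => X [F F0 Ft]; apply/nbhs_subshiftP; exists F => Y YX.
by exists F; rewrite /rate ?YX.
Qed.

Hypotheses (countG : ([set: G] #= [set: nat])%card) (genS : generates S)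
  (amenG : amenable R S).
Variable c : R.
Hypothesis approx : forall (X : subshift G A) (K : {fset G}) (eps : R),
  shift_set X !=set0 -> c <= hent R X -> 0 < eps ->
  exists Y : subshift G A,
    [/\ patterns K Y = patterns K X, c <= hent R Y & hent R Y < c + eps].

(** At stage [n] the window absorbs the [n]-th group element and a set [F] witnessing a rate below
    [c + 1/(n+1)]. All later shifts and the limit keep this rate, so the limit has entropy at most
    [c]; every rate of the limit is also a rate of some stage, hence at least [c]. *)
Lemma exact_approx (X : subshift G A) (K : {fset G}) :
    shift_set X !=set0 -> c <= hent R X ->
  exists Y : subshift G A, [/\ patterns K Y = patterns K X,
    shift_set Y !=set0 & hent R Y = c].
Proof.
move=> X0 cX; have [code [enumG [codeK _]]] := numbering countG.
pose state := (subshift G A * {fset G})%type.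
have step (ns : nat * state) : exists s' : state,
    shift_set ns.2.1 !=set0 -> c <= hent R ns.2.1 ->
    [/\ shift_set s'.1 !=set0, c <= hent R s'.1,
      patterns ns.2.2 s'.1 = patterns ns.2.2 ns.2.1,
      {subset enumG ns.1 |` ns.2.2 <= s'.2}%fset &
      exists F, [/\ F != fset0, {subset F <= s'.2} & rate R F s'.1 < c + ns.1.+1%:R^-1]].
  have [Y0|] := pselect (shift_set ns.2.1 !=set0); last by exists ns.2.
  have [cY|] := pselect (c <= hent R ns.2.1); last by exists ns.2.
  have e0 : 0 < ns.1.+1%:R^-1 :> R by rewrite invr_gt0.
  have [Y [YX cY' Ye]] := approx ns.2.2 Y0 cY e0.
  have Yn0 : shift_set Y !=set0 by exact: patterns_nonempty (esym YX) Y0.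
  have [F F0 Ft] := hent_lt Yn0 Ye.
  exists (Y, (enumG ns.1 |` ns.2.2 `|` F)%fset) => _ _; split=> //=.
    by move=> g gK; rewrite inE gK.
  by exists F; split=> // g gF; rewrite inE gF orbT.
have [f fP] := choice step.
pose s := fix s n := if n is m.+1 then f (m, s m) else ((X, K) : state).
have sP n : shift_set (s n).1 !=set0 /\ c <= hent R (s n).1.
  elim: n => [//|n [sn0 csn]]; have [] := fP (n, s n) sn0 csn; by [].
have sS n := fP (n, s n) (sP n).1 (sP n).2.
pose Z n := (s n).1; pose L n := (s n).2.
have L_mono n : {subset L n <= L n.+1}.
  by move=> g gL; have [_ _ _ + _] := sS n; apply; exact: fset1Ur.
have L_cover g : exists n, g \in L n.
  exists (code g).+1; have [_ _ _ + _] := sS (code g).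
  by apply; rewrite /= codeK fset1U1.
have LZ n : patterns (L n) (Z n.+1) = patterns (L n) (Z n).
  by have [_ _ + _ _] := sS n.
have [Y YZ] := limit_shift L_mono L_cover LZ; exists Y.
have Yn0 : shift_set Y !=set0 by exact: patterns_nonempty (esym (YZ 0%N)) X0.
split=> //; first exact: (YZ 0%N).
apply/eqP; rewrite eq_le; apply/andP; split.
  apply/ler_addgt0Pr => e e0; have [n ne] : exists n, n.+1%:R^-1 < e :> R.
    by have [n] := ltr_add_invr e0; rewrite add0r; exists n.
  have [_ _ _ _ [F [F0 FL Ft]]] := sS n.
  apply: le_trans (hent_le R Yn0 F0) _.
  have -> : rate R F Y = rate R F (Z n.+1).
    by rewrite /rate (patterns_eq_sub FL (YZ n.+1)).
  by rewrite (le_trans (ltW Ft))// lerD2l ltW.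
apply: hent_ge => // F F0; have [n FL] := exhaust L_mono L_cover F.
rewrite /rate (patterns_eq_sub FL (YZ n)).
by apply: le_trans (sP n).2 (hent_le R (sP n).1 F0).
Qed.

(** The dense G_delta is the set of shifts of entropy [c] itself: the intersection of the open sets
    [O n], dense by [exact_approx]. *)
Lemma comeagre_of_approx :
  comeagre ((set_val : shifts_ge S A c -> subshift G A) @^-1` shifts_eq S A c).
Proof.
set V := set_val.
have Vge (X : shifts_ge S A c) : shift_set (V X) !=set0 /\ c <= hent R (V X).
  have : (c%:E <= entropy R S (V X))%E by have := set_valP X; rewrite /shifts_ge.
  have [V0|V0] := pselect (shift_set (V X) !=set0).
    by rewrite (entropy_nonempty genS amenG V0) lee_fin.
  by rewrite (entropy_empty amenG V0).
have VE (X : shifts_ge S A c) : entropy R S (V X) = (hent R (V X))%:E.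
  exact: entropy_nonempty (Vge X).1.
pose O n := [set X : subshift G A | exists2 F, F != fset0 & rate R F X < c + n.+1%:R^-1].
exists (V @^-1` shifts_eq S A c); split=> //.
  exists (fun n => V @^-1` O n).
    by move=> n; exists (O n) => //; exact: open_rate_lt.
  apply/seteqP; split=> X.
    rewrite /shifts_eq /= VE => -[Xc] n _; have [V0 _] := Vge X.
    have [|F F0 Ft] := @hent_lt R _ _ _ V0 (c + n.+1%:R^-1); last by exists F.
    by rewrite Xc ltrDl invr_gt0.
  move=> XO; rewrite /shifts_eq /= VE; congr EFin; have [V0 cV] := Vge X.
  apply/eqP; rewrite eq_le cV andbT.
  apply/ler_addgt0Pr => e e0; have [n ne] : exists n, n.+1%:R^-1 < e :> R.
    by have [n] := ltr_add_invr e0; rewrite add0r; exists n.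
  have [F F0 Ft] := XO n I; apply: le_trans (hent_le R V0 F0) _.
  by rewrite (le_trans (ltW Ft))// lerD2l ltW.
move=> B B0 oB; have [U oU BE] := oB; have [X BX] := B0; subst B.
have /nbhs_subshiftP[K KU] : nbhs (V X) U by exact: open_nbhs_nbhs.
have [V0 cV] := Vge X; have [Y [YX Y0 Yc]] := exact_approx K V0 cV.
have Yge : Y \in shifts_ge S A c.
  by rewrite inE /shifts_ge/= (entropy_nonempty genS amenG Y0) Yc.
exists (SigSub Yge); split; first exact: KU.
by rewrite /shifts_eq/= (entropy_nonempty genS amenG Y0) Yc.
Qed.

End Generic.

Theorem theorem1p4 (R : realType) (G : groupType) (S : {fset G}) (A : finType)
    (countG : ([set: G] #= [set: nat])%card) (genS : generates S)
    (amenG : amenable R S) (c : R) (c0 : 0 <= c) :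
  comeagre ((set_val : shifts_ge S A c -> subshift G A) @^-1` shifts_eq S A c).
Proof.
apply: comeagre_of_approx => // X K eps X0 cX eps0.
exact: (approx_entropy countG genS amenG).
Qed.
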